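(* Let $F:\mathbb{R}^n\to\mathbb{R}$ be of class $C^2$, let $c\in\mathbb{R}$, let $u_\pm\in\mathbb{R}^n$ satisfy $\nabla F(u_\pm)=0$, and let $w^*:\mathbb{R}\to\mathbb{R}^n$ be a solution of $$w_{\xi\xi}+c\,w_\xi+\nabla F(w)=0,\qquad\lim_{\xi\to-\infty}w(\xi)=u_-,\quad\lim_{\xi\to+\infty}w(\xi)=u_+$$ (i.e. $u(x,t)=w^*(x-ct)$ is a traveling wave of $u_t=u_{xx}+\nabla F(u)$). Let $B(\xi)=\nabla^2F(w^*(\xi))$ and assume that the limits $B(\pm\infty)=\lim_{\xi\to\pm\infty}B(\xi)$ are both negative definite. Assume that $w^*$ is nondegenerate, i.e. $0$ is a simple eigenvalue of $$L=\frac{d^2}{d\xi^2}+c\frac{d}{d\xi}+B(\xi).$$ If there exists $\xi_0\in\mathbb{R}$ such that $\frac{d}{d\xi}w^*\big|_{\xi=\xi_0}=0$, then $w^*$ is spectrally unstable.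
   Context: The operator $L$ acts in $L^2$ with domain $W^{2,2}(\mathbb{R},\mathbb{C}^n)$, and eigenvalues are those with eigenfunctions in this domain. A nondegenerate wave $w^*$ is called spectrally stable if all nonzero eigenvalues of $L$ are negative; it is spectrally unstable if it is not spectrally stable. *)

(* Defs.v *)
From HB Require Import structures.
From mathcomp Require Import all_boot all_order all_algebra.
From mathcomp Require Import complex.
From mathcomp Require Import all_classical all_reals all_analysis.

Set Implicit Arguments.
Unset Strict Implicit.
Unset Printing Implicit Defensive.

Import Order.TTheory GRing.Theory Num.Theory.
Import numFieldNormedType.Exports.

Local Open Scope classical_set_scope.
Local Open Scope ring_scope.

Section Gradient.
Context {R : realType} {n : nat}.
Implicit Types F : 'cV[R]_n -> R.

Definition partial (i : 'I_n) F : 'cV[R]_n -> R :=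
  fun x => 'D_(delta_mx i 0) F x.

Definition classC1 F : Prop :=
  forall i, (forall x, derivable F x (delta_mx i 0)) /\
            continuous (partial i F).

Definition classC2 F : Prop := classC1 F /\ forall i, classC1 (partial i F).

Definition gradient F (x : 'cV[R]_n) : 'cV[R]_n := \col_i partial i F x.

Definition hessian F (x : 'cV[R]_n) : 'M[R]_n :=
  \matrix_(i, j) partial i (partial j F) x.

Definition negative_definite (M : 'M[R]_n) : Prop :=
  forall v : 'cV[R]_n, v != 0 -> (v^T *m M *m v) 0 0 < 0.

Definition traveling_wave F (c : R) (um up : 'cV[R]_n) (w : R -> 'cV[R]_n)
    : Prop :=
  [/\ forall x, derivable w x 1 /\ derivable (derive1 w) x 1,
      forall x, derive1n 2 w x + c *: derive1 w x + gradient F (w x) = 0,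
      w x @[x --> -oo] --> um &
      w x @[x --> +oo] --> up].

End Gradient.

Section Sobolev.
Context {R : realType}.

(* Smooth and compactly supported. *)
Definition test_function (phi : R -> R) : Prop :=
  (forall k x, derivable (derive1n k phi) x 1) /\
  compact (closure [set x | phi x != 0]).

(* Meant for f, g in L^2, so that both integrands are integrable. *)
Definition weak_derivative (f g : R -> R) : Prop :=
  forall phi, test_function phi ->
    \int[@lebesgue_measure R]_x (f x * derive1 phi x) =
    - \int[@lebesgue_measure R]_x (g x * phi x).

Context {n : nat}.
(* Elements of L^2(R, C^n) are represented by Borel functions, and all the
   notions below are considered up to equality almost everywhere. *)
Implicit Types f g h u v : R -> 'cV[R[i]]_n.

Definition re_coord f (i : 'I_n) : R -> R := fun x => complex.Re (f x i 0).
Definition im_coord f (i : 'I_n) : R -> R := fun x => complex.Im (f x i 0).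

Definition L2 f : Prop :=
  forall i, re_coord f i \in Lfun (@lebesgue_measure R) 2%:E /\
            im_coord f i \in Lfun (@lebesgue_measure R) 2%:E.

(* The test functions are real-valued, so that weak differentiation acts
   separately on real and imaginary parts. *)
Definition weak_derivative_Cn f g : Prop :=
  forall i, weak_derivative (re_coord f i) (re_coord g i) /\
            weak_derivative (im_coord f i) (im_coord g i).

(* f is in W^{2,2}(R, C^n), with weak derivatives f' = f1 and f'' = f2. *)
Definition W22_derivatives f f1 f2 : Prop :=
  [/\ L2 f, L2 f1, L2 f2, weak_derivative_Cn f f1 & weak_derivative_Cn f1 f2].

Definition ae_equal f g : Prop := {ae @lebesgue_measure R, forall x, f x = g x}.

End Sobolev.

Section Operator.
Context {R : realType} {n : nat}.
Variables (c : R) (B : R -> 'M[R]_n).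
Implicit Types f g h u v : R -> 'cV[R[i]]_n.

(* Graph of L = d^2/dx^2 + c d/dx + B(x) with domain W^{2,2}(R, C^n):
   f is in the domain and L f = g. *)
Definition L_graph f g : Prop :=
  exists f1 f2, W22_derivatives f f1 f2 /\
    ae_equal g (fun x => f2 x + real_complex R c *: f1 x
                         + map_mx (real_complex R) (B x) *m f x).

Definition L_eigenfunction (lambda : R[i]) f : Prop :=
  ~ ae_equal f (fun=> 0) /\ L_graph f (fun x => lambda *: f x).

Definition L_eigenvalue (lambda : R[i]) : Prop :=
  exists f, L_eigenfunction lambda f.

(* f is in the kernel of (L - lambda)^k. *)
Fixpoint ker_pow (lambda : R[i]) (k : nat) f : Prop :=
  if k is k'.+1 then
    exists2 g, L_graph f g & ker_pow lambda k' (fun x => g x - lambda *: f x)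
  else ae_equal f (fun=> 0).

(* Algebraic multiplicity one: the generalized eigenspace, that is, the union
   of the kernels of the (L - lambda)^k, is the line spanned by an
   eigenfunction. *)
Definition simple_eigenvalue (lambda : R[i]) : Prop :=
  exists2 f, L_eigenfunction lambda f &
    forall k g, ker_pow lambda k g ->
      exists a : R[i], ae_equal g (fun x => a *: f x).

End Operator.

Section Stability.
Context {R : realType} {n : nat}.
Variables (F : 'cV[R]_n -> R) (c : R) (w : R -> 'cV[R]_n).

Definition linearization : R -> 'M[R]_n := fun x => hessian F (w x).

Definition nondegenerate_wave : Prop := simple_eigenvalue c linearization 0.

(* In the order of R[i], lambda < 0 means that lambda is real and negative. *)
Definition spectrally_stable : Prop :=
  forall lambda : R[i],
    L_eigenvalue c linearization lambda -> lambda != 0 -> lambda < 0.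

Definition spectrally_unstable : Prop := ~ spectrally_stable.

End Stability.

(* Main.v *)
Require Import Defs.
From mathcomp Require Import all_boot all_order all_algebra.
From mathcomp Require Import complex.
From mathcomp Require Import all_classical all_reals all_analysis.
From mathcomp Require Import perm measurable_realfun ring lra.

Import Order.TTheory GRing.Theory Num.Theory.
Import numFieldNormedType.Exports.

Local Open Scope classical_set_scope.
Local Open Scope ring_scope.

(** The derivative w' of the wave is a bounded solution of L v = 0. If it
    vanishes identically, then w is constant, L commutes with translations, and
    the simplicity of the eigenvalue 0 makes |f|^2 periodic for an L^2
    eigenfunction f, which is impossible. Otherwise, after a reflection making
    c >= 0, restrict w' to the half-line where it ends with a zero: rounding off
    the corner there gives a compactly supported trial function of negative
    energy for L, and the set of lambda >= 0 admitting such a trial function for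
    L - lambda is bounded and open upwards. By Jacobi's criterion (the Riccati
    comparison), every such lambda has solutions of (L - lambda) f = 0 vanishing
    at some a, arbitrarily far to the left, and at some b > a. Let lambda tend
    to the supremum and a to -oo; normalized solutions converge, and they stay
    bounded because |f|^2 is monotone outside a compact set. If b stayed
    bounded, the limit would be a bounded solution ending with a zero, and the
    supremum could be raised; so the limit is a bounded solution on the whole
    line. Negativity of B at infinity makes it square integrable, an
    eigenfunction for the positive eigenvalue sup lambda. *)

(** * Derivatives of real functions *)

Section RealCalculus.
Context {R : realType}.
Implicit Types (f g F G E : R -> R) (x y a b d : R).

(** The operator is symmetric only for the weight [e^(c x)]: the form attached to [lam - L] is the
    integral of [e^(c x) (|v'|^2 - v.Bv + lam |v|^2)]. The derivative of the wave is only known to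
    be bounded, so a trial function built from it must be cut off far to the left. For [c >= 0] the
    weight stays bounded there and a linear cut-off of length [r] costs [O(1/r)]; hence the
    reflection, and the choice of the half-line to the left of the zero. No spectral theory is
    involved: the eigenfunction is a limit of solutions vanishing at both ends of intervals that
    grow to the left, normalized by their energy at the fixed point 0. Solutions are classical until
    the end; weak derivatives and [L^2] enter only when a bounded solution is turned into an
    eigenfunction and in the translation argument. Energies of trial functions are bounded through
    monotone primitives instead of integrals. *)

Definition der f x d : Prop := is_derive x (1 : R) f d.

Lemma eq_ler x y : x = y -> x <= y.
Proof. by move=> ->. Qed.

Lemma cvg_sumr (T : Type) (U : set_system T) {FU : Filter U} (I : Type)
    (r : seq I) (P : pred I) (f : I -> T -> R) (l : I -> R) :
  (forall i, P i -> f i t @[t --> U] --> l i) ->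
  \sum_(i <- r | P i) f i t @[t --> U] --> \sum_(i <- r | P i) l i.
Proof.
move=> h; elim: r => [|i r ih].
  rewrite big_nil; under eq_fun do rewrite big_nil.
  exact: cvg_cst.
rewrite big_cons; under eq_fun do rewrite big_cons.
by case: ifP => // Pi; apply: cvgD => //; apply: h.
Qed.

Lemma der_eq f x d d' : der f x d -> d = d' -> der f x d'.
Proof. by move=> h <-. Qed.

Lemma der_cst a x : der (fun=> a) x 0.
Proof. exact: is_derive_cst. Qed.

Lemma der_id x : der (fun y => y) x 1.
Proof. exact: is_derive_id. Qed.

Lemma derD f g x d d' :
  der f x d -> der g x d' -> der (fun y => f y + g y) x (d + d').
Proof. exact: is_deriveD. Qed.

Lemma derN f x d : der f x d -> der (fun y => - f y) x (- d).
Proof. exact: is_deriveN. Qed.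

Lemma derB f g x d d' :
  der f x d -> der g x d' -> der (fun y => f y - g y) x (d - d').
Proof. exact: is_deriveB. Qed.

Lemma derM f g x d d' :
  der f x d -> der g x d' -> der (fun y => f y * g y) x (d * g x + f x * d').
Proof.
move=> hf hg; apply: (der_eq _ _ _ _ (is_deriveM hf hg)).
by rewrite /GRing.scale /= addrC [g x * d]mulrC.
Qed.

Lemma der_comp f g x d d' :
  der f (g x) d -> der g x d' -> der (fun y => f (g y)) x (d * d').
Proof. exact: is_derive1_comp. Qed.

Lemma derZ a f x d : der f x d -> der (fun y => a * f y) x (a * d).
Proof.
by move=> hf; apply: (der_eq _ _ _ _ (derM _ _ _ _ _ (der_cst a x) hf)); ring.
Qed.

Lemma der_expM a x : der (fun y => expR (a * y)) x (a * expR (a * x)).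
Proof.
have h := der_comp _ _ _ _ _ (is_derive_expR (a * x)) (derZ a _ _ _ (der_id x)).
by apply: (der_eq _ _ _ _ h); ring.
Qed.

Lemma der_ext f g x d : (forall y, f y = g y) -> der f x d -> der g x d.
Proof. by move=> /funext ->. Qed.

Lemma der_near f g x d : (\near x, f x = g x) -> der f x d -> der g x d.
Proof. exact: near_eq_is_derive. Qed.

Lemma der_sum (I : Type) (r : seq I) (P : pred I) (f : I -> R -> R) (d : I -> R) x :
  (forall i, P i -> der (f i) x (d i)) ->
  der (fun y => \sum_(i <- r | P i) f i y) x (\sum_(i <- r | P i) d i).
Proof.
move=> h; elim: r => [|i r ih].
  rewrite big_nil; apply: (der_ext (fun=> 0)) (der_cst 0 x) => y.
  by rewrite big_nil.
rewrite big_cons; case: ifP => Pi.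
  apply: (der_ext (fun y => f i y + \sum_(i <- r | P i) f i y)).
    by move=> y; rewrite big_cons Pi.
  by apply: derD => //; apply: h.
by apply: der_ext ih => y; rewrite big_cons Pi.
Qed.

Lemma der_cont f x d : der f x d -> {for x, continuous f}.
Proof.
move=> [h _]; apply: differentiable_continuous; exact/derivable1_diffP.
Qed.

Lemma der_uniq f x d d' : der f x d -> der f x d' -> d = d'.
Proof. by move=> [_ <-] [_ <-]. Qed.

Lemma der_within f f' a b : (forall x, a <= x <= b -> der f x (f' x)) ->
  {within `[a, b], continuous f}.
Proof.
move=> h; apply: derivable_within_continuous => x.
by rewrite in_itv /= => /h [].
Qed.

Lemma der_mvt f f' a b : a < b -> (forall x, a <= x <= b -> der f x (f' x)) ->
  exists2 x, a < x < b & f b - f a = f' x * (b - a).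
Proof.
move=> ab h.
have [||x] := @MVT R f f' a b ab.
- by move=> x; rewrite in_itv /= => /andP[/ltW ax /ltW xb]; apply: h; rewrite ax.
- exact: der_within h.
by rewrite in_itv /= => hx e; exists x.
Qed.

Lemma der_mono f f' a b : a <= b -> (forall x, a <= x <= b -> der f x (f' x)) ->
  (forall x, a <= x <= b -> 0 <= f' x) -> f a <= f b.
Proof.
rewrite le_eqVlt => /predU1P[->//|ab] h h0.
have [x /andP[/ltW ax /ltW xb] e] := der_mvt _ _ _ _ ab h.
by rewrite -subr_ge0 e mulr_ge0 ?subr_ge0 ?(ltW ab)// h0 // ax.
Qed.

Lemma der_mono_le f f' g g' a b : a <= b ->
  (forall x, a <= x <= b -> der f x (f' x)) ->
  (forall x, a <= x <= b -> der g x (g' x)) ->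
  (forall x, a <= x <= b -> f' x <= g' x) -> f b - f a <= g b - g a.
Proof.
move=> ab hf hg h.
have : g a - f a <= g b - f b.
  apply: (der_mono (fun x => g x - f x) (fun x => g' x - f' x)) => // x hx.
    exact: derB (hg x hx) (hf x hx).
  by rewrite subr_ge0 h.
lra.
Qed.

Lemma der_abs_le f f' g g' a b : a <= b ->
  (forall x, a <= x <= b -> der f x (f' x)) ->
  (forall x, a <= x <= b -> der g x (g' x)) ->
  (forall x, a <= x <= b -> `|f' x| <= g' x) -> `|f b - f a| <= g b - g a.
Proof.
move=> ab hf hg h; rewrite ler_norml; apply/andP; split.
  have := @der_mono_le (fun x => - f x) (fun x => - f' x) g g' a b ab.
  have -> : - f b - - f a = - (f b - f a) by ring.
  rewrite lerNl; apply => // x hx; first exact: derN (hf x hx).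
  by apply: le_trans (h x hx); rewrite -normrN ler_norm.
apply: (der_mono_le f f' g g') => // x hx.
by apply: le_trans (h x hx); rewrite ler_norm.
Qed.

Lemma der_abs_le0 f f' g g' x t : (forall x, der f x (f' x)) ->
  (forall x, der g x (g' x)) -> (forall x, `|f' x| <= g' x) ->
  f t = 0 -> g t = 0 -> `|f x| <= `|g x|.
Proof.
move=> hf hg h f0 g0; have [tx|xt] := leP t x.
  have := der_abs_le f f' g g' t x tx (fun x _ => hf x) (fun x _ => hg x) (fun x _ => h x).
  by rewrite f0 g0 !subr0 => /le_trans; apply; rewrite ler_norm.
have := der_abs_le f f' g g' x t (ltW xt) (fun x _ => hf x) (fun x _ => hg x) (fun x _ => h x).
by rewrite f0 g0 !sub0r normrN => /le_trans; apply; rewrite -normrN ler_norm.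
Qed.

Lemma der0_cst f a b : a <= b -> (forall x, a <= x <= b -> der f x 0) -> f b = f a.
Proof.
move=> ab h; have : `|f b - f a| <= 0 - 0.
  apply: (der_abs_le f (fun=> 0) (fun=> 0) (fun=> 0)) => // x _ ; last by rewrite normr0.
  exact: der_cst.
by rewrite subrr normr_le0 subr_eq0 => /eqP.
Qed.

(* Backward estimates come from the same lemma applied to [x |-> E (- x)]. *)
Lemma gronwall E E' C e a b : 0 < C -> a <= b ->
  (forall x, a <= x <= b -> der E x (E' x)) ->
  (forall x, a <= x <= b -> E' x <= C * E x + e) ->
  E b + e / C <= (E a + e / C) * expR (C * (b - a)).
Proof.
move=> C0 ab hE h.
have := @der_mono (fun x => - (expR (- C * x) * (E x + e / C)))
  (fun x => - (- C * expR (- C * x) * (E x + e / C) + expR (- C * x) * (E' x + 0))) a b ab.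
rewrite lerN2 => /(_ _ _)/wrap[||H].
- by move=> x hx; apply/derN/derM; [exact: der_expM|apply: derD; [exact: hE|exact: der_cst]].
- move=> x hx; have -> : - (- C * expR (- C * x) * (E x + e / C) + expR (- C * x) * (E' x + 0))
     = expR (- C * x) * (C * E x + C * (e / C) - E' x) by ring.
  by rewrite mulr_ge0 ?expR_ge0// subr_ge0 mulrCA divff ?gt_eqF// mulr1 h.
have -> : (E a + e / C) * expR (C * (b - a)) =
    expR (C * b) * (expR (- C * a) * (E a + e / C)).
  by rewrite [C * (b - a)](_ : _ = C * b + - C * a) ?expRD; ring.
have -> : E b + e / C = expR (C * b) * (expR (- C * b) * (E b + e / C)).
  by rewrite mulrA mulNr expRxMexpNx_1 mul1r.
by rewrite ler_wpM2l ?expR_ge0.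
Qed.

Lemma near_dist f x e : {for x, continuous f} -> 0 < e ->
  exists2 d, 0 < d & forall y, `|y - x| < d -> `|f y - f x| < e.
Proof.
move=> /cvgrPdist_lt/(_ _)/[apply] /nbhs_ballP[d d0 h].
exists d => // y yx; rewrite distrC; apply: h.
by rewrite /ball /= distrC.
Qed.

Lemma dist_cont f x :
  (forall e, 0 < e -> exists2 d, 0 < d & forall y, `|y - x| < d -> `|f y - f x| < e) ->
  {for x, continuous f}.
Proof.
move=> h; apply/cvgrPdist_lt => e /h[d d0 hd].
by apply/nbhs_ballP; exists d => // y; rewrite /ball /= distrC => /hd; rewrite distrC.
Qed.

Lemma near_ball (P : R -> Prop) x d :
  0 < d -> (forall y, `|y - x| < d -> P y) -> \forall y \near x, P y.
Proof.
move=> d0 h; apply/nbhs_ballP; exists d => // y.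
by rewrite /ball /= distrC; apply: h.
Qed.

Lemma antiderivative_window f (N : R) : continuous f -> 0 < N ->
  exists F, F 0 = 0 /\ forall x, `|x| < N -> der F x (f x).
Proof.
move=> cf N0.
(* The integral starts at [- N], to the left of the whole window, because the fundamental theorem
   differentiates in the upper bound only. *)
pose G x := \int[@lebesgue_measure R]_(t in `[- N, x]) f t.
exists (fun x => G x - G 0); split; first by rewrite subrr.
move=> x; rewrite ltr_norml => /andP[Nx xN].
rewrite -[f x]subr0; apply: derB; last exact: der_cst.
have int : (@lebesgue_measure R).-integrable `[- N, N] (EFin \o f).
  by apply: continuous_compact_integrable; [exact: segment_compact|exact: continuous_subspaceT].
have [d e] := @continuous_FTC1_closed R f (- N) x N xN int Nx (cf x).
by apply: (DeriveDef d); rewrite -derive1E e.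
Qed.

(** Primitives on two windows vanish at 0 and have the same derivative, so they agree where both are
    defined. Reading the value at [x] in the window of half-width [|x| + 1] glues them into one
    function. *)
Lemma antiderivative f t : continuous f ->
  exists F, F t = 0 /\ forall x, der F x (f x).
Proof.
move=> cf.
suff [F hF] : exists F, forall x, der F x (f x).
  exists (fun x => F x - F t); split; first by rewrite subrr.
  by move=> x; rewrite -[f x]subr0; apply: derB; [exact: hF|exact: der_cst].
have /choice[G hG] (N : R) : exists F, 0 < N ->
    F 0 = 0 /\ forall x, `|x| < N -> der F x (f x).
  have [/(antiderivative_window f N cf)[F hF]|h] := pselect (0 < N); first by exists F.
  by exists (fun=> 0).
have uniq (M N y : R) : `|y| < N -> `|y| < M -> G N y = G M y.
  move=> yN yM.
  have [GN0 dN] := hG N (le_lt_trans (normr_ge0 _) yN).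
  have [GM0 dM] := hG M (le_lt_trans (normr_ge0 _) yM).
  have h z : `|z| <= `|y| -> der (fun z => G N z - G M z) z 0.
    move=> zy; rewrite -(subrr (f z)).
    by apply: derB; [apply: dN|apply: dM]; apply: le_lt_trans zy _.
  apply/eqP; rewrite -subr_eq0; apply/eqP.
  have e0 : G N 0 - G M 0 = 0 by rewrite GN0 GM0 subrr.
  have [y0|y0] := leP 0 y.
    rewrite -e0; apply: (der0_cst (fun z => G N z - G M z)) => // z /andP[z0 zy].
    by apply: h; rewrite !ger0_norm.
  rewrite -e0; apply/esym; apply: (der0_cst (fun z => G N z - G M z)) => //.
    exact: ltW.
  move=> z /andP[z0 zy]; apply: h; rewrite (ltr0_norm y0) ler0_norm// lerN2//.
exists (fun x => G (`|x| + 1) x) => x.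
have p0 : 0 < `|x| + 2 by rewrite ltr_wpDl.
have [_ dx] := hG _ p0.
apply: der_near (dx x _); last by rewrite ltrDl.
apply: (near_ball _ _ 1) => // y yx.
have := lerB_dist y x => hy; apply: uniq; last by lra.
have := lerB_normD y x; have := ler_normD (y - x) x; rewrite subrK; lra.
Qed.

End RealCalculus.

(** * Global existence for linear differential equations *)

Section LinearODE.
Context {R : realType}.
Local Notation h := (2^-1 : R).

(** The brackets [S k - 2 C h^k] and [S k + 2 C h^k] are nondecreasing and nonincreasing in [k]. The
    supremum of the lower ones lies in all brackets, which gives the limit and the rate together. *)
Lemma geometric_limit (S : nat -> R) (C : R) :
  (forall k, `|S k.+1 - S k| <= C * h ^+ k) ->
  exists z, forall k, `|z - S k| <= 2 * C * h ^+ k.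
Proof.
move=> hS.
have C0 : 0 <= C by have := hS 0%N; rewrite expr0 mulr1; apply: le_trans.
have hk0 k : 0 <= C * h ^+ k by rewrite mulr_ge0// exprn_ge0.
pose l k := S k - 2 * C * h ^+ k.
pose u k := S k + 2 * C * h ^+ k.
have lS : {homo l : m n / (m <= n)%N >-> m <= n}.
  apply: homo_leq => [x //|x y z|k]; first exact: le_trans.
  by rewrite /l exprS; have := hS k; rewrite ler_norml; lra.
have uS : {homo u : m n / (m <= n)%N >-> n <= m}.
  apply: homo_leq => [x //|x y z xy yz|k]; first exact: le_trans xy.
  by rewrite /u exprS; have := hS k; rewrite ler_norml; lra.
have lu m k : l m <= u k.
  apply: (@le_trans _ _ (l (maxn m k))); first by rewrite lS// leq_maxl.
  apply: (@le_trans _ _ (u (maxn m k))); last by rewrite uS// leq_maxr.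
  by rewrite /l /u; have := hk0 (maxn m k); lra.
exists (sup (range l)) => k.
have h1 : l k <= sup (range l).
  apply: ub_le_sup; last by exists k.
  by exists (u k) => _ [m _ <-].
have h2 : sup (range l) <= u k.
  by apply: ge_sup; [exists (l k); exists k|move=> _ [m _ <-]].
by rewrite ler_norml; move: h1 h2; rewrite /l /u; lra.
Qed.

Lemma le0_geometric (a C : R) : (forall k : nat, a <= C * h ^+ k) -> a <= 0.
Proof.
move=> H; rewrite leNgt; apply/negP => a0.
have C0 : 0 < C by apply: lt_le_trans a0 _; have := H 0%N; rewrite expr0 mulr1.
have [k hk] : exists k : nat, `|h ^+ k| < a / C.
  have := @cvg_expr R h; rewrite ger0_norm// => /(_ _)/wrap[]; first lra.
  move=> /cvgrPdist_lt/(_ (a / C)); rewrite divr_gt0// => /(_ isT)[k _ /(_ k)].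
  by rewrite /= sub0r normrN => hk; exists k; apply: hk.
have := H k; rewrite leNgt mulrC -ltr_pdivlMr//.
by rewrite (le_lt_trans (ler_norm _) hk).
Qed.

Section Picard.
Variables (I : finType) (A : I -> I -> R -> R) (K t : R).
Hypotheses (K0 : 0 < K) (A_cont : forall i j, continuous (A i j))
  (A_bound : forall i x, \sum_j `|A i j x| <= K).

(* The Picard map contracts by 1/2 the sup norm weighted by this function. *)
Local Definition weight (x : R) : R :=
  expR (2 * K * x - 2 * K * t) + expR (2 * K * t - 2 * K * x).

Local Lemma weight_ge1 x : 1 <= weight x.
Proof.
rewrite /weight; have := expR_ge1Dx (2 * K * x - 2 * K * t).
have := expR_ge1Dx (2 * K * t - 2 * K * x).
by have := expR_gt0 (2 * K * t - 2 * K * x); lra.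
Qed.

(** Origin of the contraction factor: the weight is [2 cosh (2 K (x - t))], its primitive is
    [sinh (2 K (x - t)) / K], and [K] times this is at most half the weight. *)
Local Lemma weight_primitive : exists s : R -> R,
  [/\ s t = 0, forall x, der s x (weight x) & forall x, `|s x| <= weight x / (2 * K)].
Proof.
have e (a x : R) : der (fun x => expR (a * (x - t))) x (a * expR (a * (x - t))).
  have h := der_comp expR (fun x => a * (x - t)) x _ _ (is_derive_expR _)
    (derZ a _ _ _ (derB _ _ _ _ _ (der_id x) (der_cst t x))).
  by apply: der_eq h _; ring.
have wE x : weight x = expR (2 * K * (x - t)) + expR (- (2 * K) * (x - t)).
  by rewrite /weight; congr (expR _ + expR _); ring.
exists (fun x => (expR (2 * K * (x - t)) - expR (- (2 * K) * (x - t))) * (2 * K)^-1).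
split.
- by rewrite subrr !mulr0 subrr mul0r.
- move=> x; have := derM _ _ _ _ _ (derB _ _ _ _ _ (e (2 * K) x) (e (- (2 * K)) x))
    (der_cst (2 * K)^-1 x).
  by move=> h; apply: der_eq h _; rewrite wE; field; rewrite gt_eqF.
- have i0 : 0 <= (2 * K)^-1 by rewrite invr_ge0; have := K0; lra.
  move=> x; rewrite normrM [`|(2 * K)^-1|]ger0_norm// ler_wpM2r// wE.
  by rewrite (le_trans (ler_normB _ _))// !ger0_norm ?expR_ge0.
Qed.

Local Lemma weight_cont : continuous weight.
Proof.
have [s [_ _ _]] := weight_primitive.
move=> x; rewrite /weight; apply: (@der_cont R _ x); apply: derD;
  (apply: der_comp; [exact: is_derive_expR|]).
- by apply: derB; [apply: derZ; exact: der_id|exact: der_cst].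
- by apply: derB; [exact: der_cst|apply: derZ; exact: der_id].
Qed.

Local Lemma picard_contraction (N : R) (g : I -> R -> R) (i : I) (G : R -> R) :
  (forall j x, `|g j x| <= N * weight x) -> G t = 0 ->
  (forall x, der G x (\sum_j A i j x * g j x)) ->
  forall x, `|G x| <= N * h * weight x.
Proof.
move=> hg G0 dG x; have [s [s0 ds hs]] := weight_primitive.
have N0 : 0 <= N.
  have := le_trans (normr_ge0 _) (hg i t).
  by rewrite pmulr_lge0// (lt_le_trans _ (weight_ge1 t)).
apply: (@le_trans _ _ `|N * K * s x|).
  apply: (der_abs_le0 G (fun x => \sum_j A i j x * g j x) (fun x => N * K * s x) (fun x => N * K * weight x) x t) => //.
  - by move=> y; apply: derZ; exact: ds.
  - move=> y; apply: (le_trans (ler_norm_sum _ _ _)).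
    apply: (@le_trans _ _ (\sum_j `|A i j y| * (N * weight y))).
      by apply: ler_sum => j _; rewrite normrM ler_wpM2l.
    rewrite -mulr_suml (_ : N * K * weight y = K * (N * weight y)); last by ring.
    rewrite ler_wpM2r// mulr_ge0//.
    by rewrite (le_trans ler01)// weight_ge1.
  - by rewrite s0 mulr0.
rewrite normrM ger0_norm ?mulr_ge0 ?(ltW K0)//.
apply: (@le_trans _ _ (N * K * (weight x / (2 * K)))).
  by rewrite ler_wpM2l// mulr_ge0 ?(ltW K0).
by apply/eq_ler; field; rewrite gt_eqF.
Qed.

Local Lemma continuous_lin (g : I -> R -> R) (i : I) :
  (forall j, continuous (g j)) -> continuous (fun x => \sum_j A i j x * g j x).
Proof.
move=> cg x; apply: cvg_sumr => j _; apply: cvgM; [exact: A_cont|exact: cg].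
Qed.

(** In the weighted norm the Picard iterates converge on the whole line at once, so no local
    solutions have to be continued. *)
Lemma linear_ode (z0 : I -> R) : exists z : I -> R -> R,
  (forall i, z i t = z0 i) /\ forall i x, der (z i) x (\sum_j A i j x * z j x).
Proof.
(* [P f] is the primitive of [f] vanishing at [t] when [f] is continuous, and an arbitrary function
   otherwise. *)
have /choice[P hP] (f : R -> R) : exists F, continuous f ->
    F t = 0 /\ forall x, der F x (f x).
  have [/(antiderivative f t)[F hF]|nf] := pselect (continuous f); first by exists F.
  by exists (fun=> 0).
pose S := fix S (k : nat) : I -> R -> R := if k is k'.+1
  then fun i x => z0 i + P (fun y => \sum_j A i j y * S k' j y) x
  else fun i _ => z0 i.
have cS k : forall i, continuous (S k i).
  elim: k => [|k ih] i x; first exact: cvg_cst.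
  have [_ d] := hP _ (continuous_lin (S k) i ih).
  by apply: cvgD; [exact: cvg_cst|exact: der_cont (d x)].
have dS k i x : der (S k.+1 i) x (\sum_j A i j x * S k j x).
  have [_ d] := hP _ (continuous_lin (S k) i (cS k)).
  by rewrite -[X in der _ _ X]add0r; apply: derD; [exact: der_cst|exact: d].
have St k i : S k i t = z0 i.
  case: k => [//|k] /=; have [-> _] := hP _ (continuous_lin (S k) i (cS k)).
  by rewrite addr0.
pose Z := \sum_i `|z0 i|.
have z0Z i : `|z0 i| <= Z by rewrite /Z (bigD1 i)//= lerDl sumr_ge0.
have Z0 : 0 <= Z by exact: sumr_ge0.
have SD k i x : `|S k.+1 i x - S k i x| <= Z * weight x * h ^+ k.
  elim: k i x => [|k ih] i x.
    apply: (@le_trans _ _ (Z * h * weight x)); last first.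
      by rewrite expr0; have := weight_ge1 x; nra.
    apply: (picard_contraction Z (fun i _ => z0 i) i (fun x => S 1%N i x - S 0%N i x)) => //.
    - by move=> j y; have := z0Z j; have := weight_ge1 y; nra.
    - by rewrite !St subrr.
    - by move=> y; rewrite -[X in der _ _ X]subr0; apply: derB; [exact: dS|exact: der_cst].
  rewrite exprSr -mulrA [weight x * _]mulrC mulrA mulrA.
  apply: (picard_contraction (Z * h ^+ k) (fun j y => S k.+1 j y - S k j y) i
    (fun x => S k.+2 i x - S k.+1 i x)) => //.
  - by move=> j y; rewrite mulrAC.
  - by rewrite !St subrr.
  - move=> y; have := derB _ _ _ _ _ (dS k.+1 i y) (dS k i y).
    by rewrite -sumrB => d; apply: der_eq d _; apply: eq_bigr => j _; rewrite mulrBr.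
have /choice[z' hz'] (p : I * R) : exists z, forall k, `|z - S k p.1 p.2| <= 2 * (Z * weight p.2) * h ^+ k.
  by apply: geometric_limit => k; exact: SD.
pose z i x := z' (i, x).
have hz i x k : `|z i x - S k i x| <= 2 * Z * h ^+ k * weight x.
  by have := hz' (i, x) k; rewrite /= -/(z i x) => /le_trans; apply; apply/eq_ler; ring.
have cz i : continuous (z i).
  move=> x; apply: dist_cont => e e0.
  (* Near [x] the weight exceeds [weight x] by less than 1, so the error of the [k]-th iterate is
     uniformly small there and the [e / 3] argument applies. *)
  have [k hk] : exists k : nat, 2 * Z * h ^+ k * (weight x + 1) < e / 3.
    apply: contrapT => hn.
    have : e / 3 <= 0.
      apply: (@le0_geometric _ (2 * Z * (weight x + 1))) => k.
      rewrite leNgt; apply/negP => hk; apply: hn; exists k.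
      by apply: le_lt_trans hk; apply/eq_ler; ring.
    lra.
  have e30 : 0 < e / 3 by lra.
  have [d1 d10 hd1] := near_dist _ x _ (cS k i x) e30.
  have [d2 d20 hd2] := near_dist _ x 1 (weight_cont x) ltr01.
  exists (Num.min d1 d2); first by rewrite lt_min d10.
  move=> y; rewrite lt_min => /andP[/hd1 h1 /hd2].
  rewrite ltr_norml => /andP[_ wy].
  have b u : weight u <= weight x + 1 -> `|z i u - S k i u| < e / 3.
    move=> hu; apply: le_lt_trans hk; apply: (le_trans (hz i u k)).
    by rewrite ler_wpM2l// !mulr_ge0// exprn_ge0.
  have hy : `|z i y - S k i y| < e / 3 by apply: b; lra.
  have hx : `|z i x - S k i x| < e / 3 by apply: b; lra.
  by move: h1 hy hx; rewrite !ltr_norml; lra.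
(* For every [k], both [z] and its Picard image are within a multiple of [h ^+ k] of the iterate
   [S k.+1]; hence they coincide. *)
have zP i x : z i x = z0 i + P (fun y => \sum_j A i j y * z j y) x.
  have [P0 dP] := hP _ (continuous_lin z i cz).
  apply/esym/eqP; rewrite -subr_eq0 -normr_le0; apply/eqP/eqP.
  apply: (@le0_geometric _ (3 * Z * weight x)) => k.
  pose G y := z0 i + P (fun y => \sum_j A i j y * z j y) y - S k.+1 i y.
  have : `|G x| <= 2 * Z * h ^+ k * h * weight x.
    apply: (picard_contraction (2 * Z * h ^+ k) (fun j y => z j y - S k j y) i) => //.
    - by rewrite /G St P0 addr0 subrr.
    - move=> y; have := derB _ _ _ _ _ (derD _ _ _ _ _ (der_cst (z0 i) y) (dP y)) (dS k i y).
      rewrite add0r -sumrB => d; apply: der_eq d _.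
      by apply: eq_bigr => j _; rewrite mulrBr.
  have := hz i x k.+1; rewrite exprS /G !ler_norml.
  by lra.
exists z; split => [i|i x].
  by rewrite zP; have [-> _] := hP _ (continuous_lin z i cz); rewrite addr0.
have [_ dP] := hP _ (continuous_lin z i cz).
have := derD _ _ _ _ _ (der_cst (z0 i) x) (dP x).
by rewrite add0r; apply: der_ext => y; rewrite zP.
Qed.

End Picard.
End LinearODE.

(** * Vector-valued solutions and energy estimates *)

Section Vectors.
Context {R : realType} {n : nat}.
Implicit Types (u v w : 'cV[R]_n) (f g : R -> 'cV[R]_n) (x y a : R).

Definition dot u v : R := \sum_i u i 0 * v i 0.

Lemma dotC u v : dot u v = dot v u.
Proof. by apply: eq_bigr => i _; rewrite mulrC. Qed.

Lemma dotDl u v w : dot (u + v) w = dot u w + dot v w.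
Proof. by rewrite -big_split; apply: eq_bigr => i _; rewrite mxE mulrDl. Qed.

Lemma dotZl a u w : dot (a *: u) w = a * dot u w.
Proof. by rewrite mulr_sumr; apply: eq_bigr => i _; rewrite mxE mulrA. Qed.

Lemma dotNl u w : dot (- u) w = - dot u w.
Proof. by rewrite -scaleN1r dotZl mulN1r. Qed.

Lemma dotDr u v w : dot w (u + v) = dot w u + dot w v.
Proof. by rewrite dotC dotDl !(dotC w). Qed.

Lemma dotZr a u w : dot w (a *: u) = a * dot w u.
Proof. by rewrite dotC dotZl dotC. Qed.

Lemma dotNr u w : dot w (- u) = - dot w u.
Proof. by rewrite dotC dotNl dotC. Qed.

Lemma dot0l u : dot 0 u = 0.
Proof. by rewrite -(scale0r 0) dotZl mul0r. Qed.

Lemma dot0r u : dot u 0 = 0.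
Proof. by rewrite dotC dot0l. Qed.

Definition dotE := (dotDl, dotDr, dotNl, dotNr, dotZl, dotZr).

Lemma dot_ge0 u : 0 <= dot u u.
Proof. by apply: sumr_ge0 => i _; rewrite -expr2 sqr_ge0. Qed.

Lemma dot_coord u i : u i 0 ^+ 2 <= dot u u.
Proof.
rewrite /dot (bigD1 i)//= -expr2 lerDl; apply: sumr_ge0 => j _.
by rewrite -expr2 sqr_ge0.
Qed.

Lemma dot_eq0 u : dot u u = 0 -> u = 0.
Proof.
move=> u0; apply/matrixP => i j; rewrite ord1 mxE.
by apply/eqP; rewrite -sqrf_eq0 eq_le sqr_ge0 -u0 dot_coord.
Qed.

Lemma dot_gt0 u : u != 0 -> 0 < dot u u.
Proof.
by move=> u0; rewrite lt_def dot_ge0 andbT; apply: contra_neq u0; exact: dot_eq0.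
Qed.

Lemma dot_amgm u v : `|2 * dot u v| <= dot u u + dot v v.
Proof.
have := dot_ge0 (u - v); have := dot_ge0 (u + v).
by rewrite !dotE (dotC v u) ler_norml; lra.
Qed.

Lemma dot_mx (A : 'M[R]_n) u v : dot u (A *m v) = dot (A^T *m u) v.
Proof.
rewrite /dot; under eq_bigr do rewrite mxE mulr_sumr.
rewrite exchange_big; apply: eq_bigr => j _; rewrite mxE mulr_suml.
by apply: eq_bigr => i _; rewrite mxE mulrA [u i 0 * _]mulrC.
Qed.

Lemma dot_bilinear_bound (A : 'M[R]_n) (b : R) u v :
  (forall i j, `|A i j| <= b) -> 0 <= b ->
  `|dot u (A *m v)| <= n%:R * b * (dot u u + dot v v).
Proof.
move=> hA b0; rewrite /dot; under eq_bigr do rewrite mxE mulr_sumr.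
apply: (le_trans (ler_norm_sum _ _ _)).
apply: (@le_trans _ _ (\sum_(i < n) \sum_(j < n) b * (u i 0 * u i 0 + v j 0 * v j 0))).
  apply: ler_sum => i _; apply: (le_trans (ler_norm_sum _ _ _)); apply: ler_sum => j _.
  rewrite mulrCA normrM ler_pM//.
  have := sqr_ge0 (u i 0 - v j 0); have := sqr_ge0 (u i 0 + v j 0).
  have := sqr_ge0 (u i 0); have := sqr_ge0 (v j 0).
  by rewrite ler_norml; nra.
under eq_bigr do rewrite -mulr_sumr big_split /= sumr_const card_ord.
rewrite -mulr_sumr big_split /= sumr_const card_ord sumrMnl.
by rewrite -mulrnDl mulrnAr -mulrA mulr_natl.
Qed.

(** Coordinatewise, so that the scalar calculus above applies directly. *)
Definition vder f x (d : 'cV[R]_n) : Prop := forall i, der (fun t => f t i 0) x (d i 0).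

Lemma vder_eq f x d d' : vder f x d -> d = d' -> vder f x d'.
Proof. by move=> h <-. Qed.

Lemma vder_cst u x : vder (fun=> u) x 0.
Proof. by move=> i; rewrite mxE; exact: der_cst. Qed.

Lemma vderD f g x d d' : vder f x d -> vder g x d' -> vder (fun t => f t + g t) x (d + d').
Proof.
move=> hf hg i; rewrite mxE; apply: der_ext (derD _ _ _ _ _ (hf i) (hg i)) => t.
by rewrite mxE.
Qed.

Lemma vderZ f x d (h : R -> R) h' : der h x h' -> vder f x d ->
  vder (fun t => h t *: f t) x (h' *: f x + h x *: d).
Proof.
move=> hh hf i; rewrite !mxE; apply: der_ext (derM _ _ _ _ _ hh (hf i)) => t.
by rewrite mxE.
Qed.

Lemma vderZc f x d a : vder f x d -> vder (fun t => a *: f t) x (a *: d).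
Proof.
move=> hf; apply: vder_eq (vderZ _ _ _ _ _ (der_cst a x) hf) _.
by rewrite scale0r add0r.
Qed.

Lemma vder_dot f g x d d' : vder f x d -> vder g x d' ->
  der (fun t => dot (f t) (g t)) x (dot d (g x) + dot (f x) d').
Proof.
move=> hf hg; rewrite /dot -big_split /=; apply: der_sum => i _.
exact: derM.
Qed.

Lemma vder_ext f g x d : (forall t, f t = g t) -> vder f x d -> vder g x d.
Proof. by move=> /funext ->. Qed.

Lemma vder_comp f x d (h : R -> R) h' : vder f (h x) d -> der h x h' ->
  vder (fun t => f (h t)) x (h' *: d).
Proof.
move=> hf hh i; rewrite mxE mulrC.
exact: (der_comp (fun t => f t i 0) h).
Qed.

End Vectors.

Section Interpolation.
Context {R : realType}.

(** The mean value theorem yields a point of []x, x + 1[] where [u1] is [u (x + 1) - u x]. From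
    there back to [x], the function [u1 + c u], whose derivative is [g], changes by at most [G]. *)
Lemma bounded_derivative (u u1 g : R -> R) (c M G : R) :
  (forall x, der u x (u1 x)) -> (forall x, der u1 x (g x - c * u1 x)) ->
  (forall x, `|u x| <= M) -> (forall x, `|g x| <= G) ->
  forall x, `|u1 x| <= 2 * M + 2 * `|c| * M + G.
Proof.
move=> hu hu1 hM hG x.
have x1 : x < x + 1 by rewrite ltrDl.
have [y /andP[xy yx] e] := der_mvt u u1 x (x + 1) x1 (fun z _ => hu z).
have hk z : der (fun z => u1 z + c * u z) z (g z).
  by apply: der_eq (derD _ _ _ _ _ (hu1 z) (derZ c _ _ _ (hu z))) _; ring.
have [z /andP[xz zy] e2] := der_mvt _ _ x y xy (fun z _ => hk z).
have cM w : `|c * u w| <= `|c| * M by rewrite normrM ler_wpM2l.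
have gz : `|g z * (y - x)| <= G.
  rewrite normrM -[G]mulr1 ler_pM// ger0_norm; lra.
have := cM x; have := cM y; have := hM (x + 1); have := hM x.
move: gz; rewrite -e2; move: e; rewrite addrAC subrr add0r mulr1 => <-.
by rewrite !ler_norml; lra.
Qed.

End Interpolation.

Section SecondOrder.
Context {R : realType} {n : nat}.
Variables (c : R) (B : R -> 'M[R]_n) (K : R).
Implicit Types (f g : R -> 'cV[R]_n) (x t lam : R).

(** Classical solutions of [L f = lam f], with [f1] in the role of [f']. *)
Definition solution lam f f1 : Prop := forall x, vder f x (f1 x) /\
  vder f1 x (- (c *: f1 x) - B x *m f x + lam *: f x).

Definition energy f f1 x : R := dot (f x) (f x) + dot (f1 x) (f1 x).

Lemma energy_ge0 f f1 x : 0 <= energy f f1 x.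
Proof. by rewrite addr_ge0// dot_ge0. Qed.

Lemma solution_scale lam a f f1 : solution lam f f1 ->
  solution lam (fun x => a *: f x) (fun x => a *: f1 x).
Proof.
move=> h x; have [h1 h2] := h x; split; first exact: vderZc.
apply: vder_eq (vderZc _ _ _ a h2) _.
by rewrite !scalerDr !scalerN -scalemxAr !scalerA [a * c]mulrC [a * lam]mulrC.
Qed.

Hypotheses (K0 : 0 < K)
  (B_form : forall x u v, `|dot u (B x *m v)| <= K * (dot u u + dot v v)).

(** Gronwall rate of the energy, uniform over [|lam| <= L]. The 2 collects one unit from [2 f.f1]
    and one from [2 f1.r], where [r] is a forcing term; the other terms come from [c], [B] and
    [lam]. *)
Definition growth (L : R) : R := 2 + 2 * `|c| + 2 * K + L.

Lemma growth_gt0 L : 0 <= L -> 0 < growth L.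
Proof. by move=> L0; rewrite /growth; have := normr_ge0 c; have := K0; lra. Qed.

(* The forcing term serves to compare solutions for different [lam]. *)
Lemma energy_bound lam (L e : R) f f1 (r : R -> 'cV[R]_n) x t : `|lam| <= L ->
  (forall y, vder f y (f1 y) /\ vder f1 y (- (c *: f1 y) - B y *m f y + lam *: f y + r y)) ->
  (forall y, `|y - t| <= `|x - t| -> dot (r y) (r y) <= e) ->
  energy f f1 x <= (energy f f1 t + e / growth L) * expR (growth L * `|x - t|).
Proof.
move=> hL hf hr.
have L0 : 0 <= L by exact: le_trans hL.
have C0 := growth_gt0 L L0.
have e0 : 0 <= e by apply: (le_trans (dot_ge0 (r t))); apply: hr; rewrite subrr normr0.
have eC : 0 <= e / growth L by rewrite divr_ge0// ltW.
pose E' y := 2 * dot (f y) (f1 y) + 2 * dot (f1 y) (- (c *: f1 y) - B y *m f y + lam *: f y + r y).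
have dE y : der (energy f f1) y (E' y).
  have [h1 h2] := hf y; apply: der_eq (derD _ _ _ _ _ (vder_dot _ _ _ _ _ h1 h1) (vder_dot _ _ _ _ _ h2 h2)) _.
  by rewrite /E' (dotC (f1 y) (f y)) (dotC (_ + r y) (f1 y)); ring.
have bE y : `|y - t| <= `|x - t| -> `|E' y| <= growth L * energy f f1 y + e.
  move=> /hr hry; rewrite /E' /energy /growth !dotE.
  have := dot_amgm (f y) (f1 y); have := dot_amgm (f1 y) (r y).
  have := B_form y (f1 y) (f y); rewrite (dotC (f1 y) (f y)).
  have := dot_ge0 (f y); have := dot_ge0 (f1 y).
  have h1 : `|c * dot (f1 y) (f1 y)| <= `|c| * dot (f1 y) (f1 y).
    by rewrite normrM (ger0_norm (dot_ge0 _)).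
  have h2 : `|lam * (2 * dot (f y) (f1 y))| <= L * (dot (f y) (f y) + dot (f1 y) (f1 y)).
    by rewrite normrM ler_pM// dot_amgm.
  have h3 : 0 <= `|c| * dot (f y) (f y) by rewrite mulr_ge0 ?dot_ge0.
  move: h1 h2 h3; rewrite !ler_norml.
  by lra.
have [tx|xt] := leP t x.
  have H : energy f f1 x + e / growth L <= (energy f f1 t + e / growth L) * expR (growth L * (x - t)).
    apply: (gronwall _ E') => // y /andP[ty yx].
    apply: (le_trans (ler_norm _)); apply: bE.
    by rewrite !ger0_norm ?subr_ge0// lerD2r.
  rewrite ger0_norm ?subr_ge0//; lra.
have H : energy f f1 (- - x) + e / growth L <= (energy f f1 (- - t) + e / growth L) * expR (growth L * (- x - - t)).
  apply: (gronwall (fun y => energy f f1 (- y)) (fun y => E' (- y) * (- 1))) => //.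
  - by rewrite lerN2 ltW.
  - by move=> y _; apply: der_comp (dE _) (derN _ _ _ (der_id y)).
  - move=> y /andP[ty yx]; rewrite mulrN1.
    apply: (le_trans (ler_norm _)); rewrite normrN; apply: bE.
    rewrite !ler0_norm ?subr_le0//; lra.
by move: H; rewrite !opprK ltr0_norm ?subr_lt0// opprB [- x + t]addrC; lra.
Qed.

Lemma solution_energy lam L f f1 x t : `|lam| <= L -> solution lam f f1 ->
  energy f f1 x <= energy f f1 t * expR (growth L * `|x - t|).
Proof.
move=> hL hf; have := energy_bound lam L 0 f f1 (fun=> 0) x t hL.
rewrite mul0r addr0; apply => [y|y _]; last by rewrite dot0l.
by have [h1 h2] := hf y; split => //; rewrite addr0.
Qed.

Lemma solution_eq0 lam f f1 t : solution lam f f1 -> f t = 0 -> f1 t = 0 ->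
  forall x, f x = 0 /\ f1 x = 0.
Proof.
move=> hf f0 f10 x.
have := solution_energy lam `|lam| f f1 x t (lexx _) hf.
rewrite {2}/energy f0 f10 !dot0l addr0 mul0r /energy => h.
have := dot_ge0 (f x); have := dot_ge0 (f1 x) => h1 h2.
by split; apply: dot_eq0; lra.
Qed.

Variable b : R.
Hypotheses (B_cont : forall i j, continuous (fun x => B x i j))
  (B_bound : forall x i j, `|B x i j| <= b).

Lemma solution_exists lam t u0 u1 : exists f f1,
  [/\ solution lam f f1, f t = u0 & f1 t = u1].
Proof.
(* Companion matrix of the first-order system: [inl] indexes the coordinates of [f], [inr] those of
   [f1]. *)
pose A (p q : 'I_n + 'I_n) (x : R) : R := match p, q with
  | inl i, inl j => 0 | inl i, inr j => (i == j)%:R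
  | inr i, inl j => lam * (i == j)%:R - B x i j | inr i, inr j => - c * (i == j)%:R end.
have cA p q : continuous (A p q).
  case: p => i; case: q => j x; rewrite /A; try exact: cvg_cst.
  by apply: cvgB; [exact: cvg_cst|exact: B_cont].
pose a := 1 + `|lam| + `|b| + `|c|.
have a0 : 0 < a by rewrite /a; have := normr_ge0 lam; have := normr_ge0 b; have := normr_ge0 c; lra.
have bA p q x : `|A p q x| <= a.
  have d (i j : 'I_n) (m : R) : `|m * (i == j)%:R| <= `|m|.
    by rewrite normrM ler_piMr//; case: (i == j); rewrite ?normr1 ?normr0.
  rewrite /a; have := normr_ge0 lam; have := normr_ge0 b; have := normr_ge0 c.
  case: p => i; case: q => j; rewrite /A.
  - by rewrite normr0; lra.
  - by have := d i j 1; rewrite mul1r normr1; lra.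
  - have := d i j lam; have := B_bound x i j; have := ler_norm b.
    by have := ler_normB (lam * (i == j)%:R) (B x i j); lra.
  - by have := d i j (- c); rewrite normrN; lra.
pose K1 : R := 1 + a *+ #|{: 'I_n + 'I_n}|.
have K10 : 0 < K1 by rewrite /K1 ltr_pwDl// mulrn_wge0// ltW.
have sA p x : \sum_q `|A p q x| <= K1.
  rewrite /K1 -sumr_const; apply: (@le_trans _ _ (\sum_(q : 'I_n + 'I_n) a)); last by rewrite lerDr.
  by apply: ler_sum.
have [z [zt dz]] := linear_ode _ A K1 t K10 cA sA (fun p => match p with inl i => u0 i 0 | inr i => u1 i 0 end).
exists (fun x => \col_i z (inl i) x), (fun x => \col_i z (inr i) x); split.
- move=> x; split => i.
    have := dz (inl i) x; rewrite big_sumType /= big1 => [|j _]; last by rewrite mul0r.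
    rewrite add0r (bigD1 i)//= eqxx mul1r big1 ?addr0; last first.
      by move=> j ji; rewrite eq_sym (negPf ji) mul0r.
    by rewrite !mxE => d; apply: der_ext d => y; rewrite mxE.
  have := dz (inr i) x; rewrite big_sumType /=.
  rewrite [X in _ + X](bigD1 i)//= eqxx mulr1 [X in _ + (_ + X)]big1 ?addr0; last first.
    by move=> j ji; rewrite eq_sym (negPf ji) mulr0 mul0r.
  under eq_bigr do rewrite mulrBl.
  rewrite sumrB (bigD1 i)//= eqxx mulr1 [X in _ + X - _]big1 ?addr0; last first.
    by move=> j ji; rewrite eq_sym (negPf ji) mulr0 mul0r.
  move=> d; have := der_ext _ (fun y => (\col_i z (inr i) y) i 0) _ _ _ d.
  move=> /(_ _)/wrap[y|]; first by rewrite mxE.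
  move=> {}d; apply: der_eq d _; rewrite !mxE.
  under [X in _ = - _ - X + _]eq_bigr do rewrite mxE.
  by ring.
- by apply/matrixP => i j; rewrite ord1 mxE zt.
- by apply/matrixP => i j; rewrite ord1 mxE zt.
Qed.

End SecondOrder.

(** * Conjugate points *)

Section MatrixCalculus.
Context {R : realType}.

Definition mder {m p} (Y : R -> 'M[R]_(m, p)) x (D : 'M[R]_(m, p)) : Prop :=
  forall i j, der (fun t => Y t i j) x (D i j).

Lemma mder_mulmx {m p} (Y : R -> 'M[R]_(m, p)) (z : R -> 'cV[R]_p) x D d :
  mder Y x D -> vder z x d ->
  vder (fun t => Y t *m z t) x (D *m z x + Y x *m d).
Proof.
move=> hY hz i; rewrite !mxE -big_split /=.
apply: (der_ext (fun t => \sum_j Y t i j * z t j 0)); first by move=> t; rewrite mxE.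
by apply: der_sum => j _; exact: derM.
Qed.

Lemma der_prod (I : Type) (r : seq I) (f : I -> R -> R) x :
  (forall i, exists d, der (f i) x d) ->
  exists d, der (fun t => \prod_(i <- r) f i t) x d.
Proof.
move=> h; elim: r => [|i r [d ih]].
  by exists 0; apply: (der_ext (fun=> 1)) (der_cst 1 x) => t; rewrite big_nil.
have [e he] := h i; eexists.
apply: (der_ext (fun t => f i t * \prod_(i <- r) f i t)); last exact: (derM _ _ _ _ _ he ih).
by move=> t; rewrite big_cons.
Qed.

(** Only the existence of a derivative is recorded: [der_frame] recovers what it needs by
    differentiating a product. *)
Lemma der_det {n} (Y : R -> 'M[R]_n) x :
  (forall i j, exists d, der (fun t => Y t i j) x d) ->
  exists d, der (fun t => \det (Y t)) x d.
Proof.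
move=> h.
have /choice[d hd] (s : {perm 'I_n}) : exists d, der (fun t => (-1) ^+ s * \prod_i Y t i (s i)) x d.
  have [d hd] := der_prod _ (index_enum 'I_n) (fun i t => Y t i (s i)) x (fun i => h i (s i)).
  by eexists; apply: derZ; exact: hd.
exists (\sum_s d s); rewrite /determinant.
by apply: der_sum => s _; exact: hd.
Qed.

Lemma der_adj {n} (Y : R -> 'M[R]_n) x i j :
  (forall i j, exists d, der (fun t => Y t i j) x d) ->
  exists d, der (fun t => (\adj (Y t)) i j) x d.
Proof.
move=> h; have [|d hd] := der_det (fun t => row' j (col' i (Y t))) x.
  move=> k l; have [e he] := h (lift j k) (lift i l); exists e.
  by apply: der_ext he => t; rewrite !mxE.
eexists; apply: (der_ext _ _ _ _ _ (derZ ((-1) ^+ (j + i)) _ _ _ hd)) => t.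
by rewrite mxE.
Qed.

End MatrixCalculus.

(** * Jacobi's criterion by Riccati comparison *)

Section Jacobi.
Context {R : realType} {n : nat}.
Variables (c : R) (B : R -> 'M[R]_n).
Hypothesis B_sym : forall x u v, dot u (B x *m v) = dot (B x *m u) v.
Implicit Types (lam : R).

(** Symmetry of [B] makes [e^(c x) (f.g1 - f1.g)] constant, and it vanishes at [a]. For the
    fundamental matrix this is the symmetry of the Riccati matrix [Y1 Y^-1]. *)
Lemma wronskian lam f f1 g g1 a : solution c B lam f f1 -> solution c B lam g g1 ->
  f a = 0 -> g a = 0 -> forall x, dot (f x) (g1 x) = dot (f1 x) (g x).
Proof.
move=> hf hg fa ga x.
pose w x := expR (c * x) * (dot (f x) (g1 x) - dot (f1 x) (g x)).
have dw y : der w y 0.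
  have [h1 h2] := hf y; have [h3 h4] := hg y.
  apply: der_eq (derM _ _ _ _ _ (der_expM c y) (derB _ _ _ _ _
    (vder_dot _ _ _ _ _ h1 h4) (vder_dot _ _ _ _ _ h2 h3))) _.
  by rewrite !dotE (B_sym y (f y)); ring.
have wa : w a = 0 by rewrite /w fa ga dot0l dot0r subrr mulr0.
have : w x = 0.
  have [ax|/ltW xa] := leP a x; rewrite -wa; last apply/esym;
  exact: der0_cst.
move/eqP; rewrite /w mulf_eq0 gt_eqF ?expR_gt0//= subr_eq0 => /eqP //.
Qed.

(** Integrand of the quadratic form of [lam - L] in the space with weight [e^(c x)]; [v1] stands for
    [v']. *)
Definition density lam (v v1 : R -> 'cV[R]_n) (x : R) : R :=
  expR (c * x) * (dot (v1 x) (v1 x) - dot (v x) (B x *m v x) + lam * dot (v x) (v x)).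

(* [G] is a primitive of a majorant of the integrand of the energy of [v] on
   [s, t], so that [G t - G s] bounds the energy without any integral. *)
Definition energy_majorant lam (s t : R) (v : R -> 'cV[R]_n) (G : R -> R) : Prop :=
  exists v1 G1 M, forall x, s <= x <= t ->
    [/\ vder v x (v1 x), der G x (G1 x), density lam v v1 x <= G1 x &
        dot (v x) (v x) <= M].

(** The trial function is [v] on [[s0, s1]] continued by [w] on [[s1, s2]]: continuous, with a
    corner allowed at [s1], and zero at both ends. Negative energy is the variational sign that the
    Dirichlet problem on [[s0, s2]] has an eigenvalue above [lam]. *)
Definition negative_index lam : Prop :=
  exists s0 s1 s2 v w G H, [/\ s0 < s1 < s2,
    energy_majorant lam s0 s1 v G, energy_majorant lam s1 s2 w H,
    [/\ v s0 = 0, v s1 = w s1 & w s2 = 0] & G s1 - G s0 + (H s2 - H s1) < 0].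

Variables (b : R) .
Hypotheses (B_cont : forall i j, continuous (fun x => B x i j))
  (B_bound : forall x i j, `|B x i j| <= b).

Lemma fundamental_matrix lam a : exists Y Y1 : R -> 'M[R]_n,
  [/\ Y a = 0, Y1 a = 1%:M, forall x, mder Y x (Y1 x) &
      forall x, mder Y1 x (- (c *: Y1 x) - B x *m Y x + lam *: Y x)].
Proof.
have /choice[p hp] (j : 'I_n) : exists p : (R -> 'cV[R]_n) * (R -> 'cV[R]_n),
    [/\ solution c B lam p.1 p.2, p.1 a = 0 & p.2 a = delta_mx j 0].
  have [f [f1 [hf fa f1a]]] := solution_exists c B b B_cont B_bound lam a 0 (delta_mx j 0).
  by exists (f, f1).
exists (fun x => \matrix_(i, j) (p j).1 x i 0), (fun x => \matrix_(i, j) (p j).2 x i 0).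
split.
- by apply/matrixP => i j; rewrite !mxE; have [_ -> _] := hp j; rewrite mxE.
- by apply/matrixP => i j; rewrite !mxE; have [_ _ ->] := hp j; rewrite mxE eqxx andbT.
- move=> x i j; have [/(_ x)[h _] _ _] := hp j; rewrite mxE.
  by apply: der_ext (h i) => t; rewrite mxE.
- move=> x i j; have [/(_ x)[_ h] _ _] := hp j.
  apply: (der_ext (fun t => (p j).2 t i 0)); first by move=> t; rewrite mxE.
  apply: der_eq (h i) _; rewrite !mxE; congr (_ - _ + _).
  by apply: eq_bigr => k _; rewrite !mxE.
Qed.

Section Riccati.
Variables (lam a : R) (Y Y1 : R -> 'M[R]_n).
Hypotheses (Ya : Y a = 0) (dY : forall x, mder Y x (Y1 x))
  (dY1 : forall x, mder Y1 x (- (c *: Y1 x) - B x *m Y x + lam *: Y x)).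

Lemma fundamental_solution u :
  solution c B lam (fun x => Y x *m u) (fun x => Y1 x *m u).
Proof.
move=> x; split.
  by apply: vder_eq (mder_mulmx _ _ _ _ _ (dY x) (vder_cst u x)) _; rewrite mulmx0 addr0.
apply: vder_eq (mder_mulmx _ _ _ _ _ (dY1 x) (vder_cst u x)) _.
by rewrite mulmx0 addr0 !mulmxDl !mulNmx -!scalemxAl mulmxA.
Qed.

(* The coordinates of [v] in the frame [Y], by Cramer's rule. *)
Local Definition frame (v : R -> 'cV[R]_n) (x : R) : 'cV[R]_n :=
  (\det (Y x))^-1 *: (\adj (Y x) *m v x).

Local Lemma frameK v x : \det (Y x) != 0 -> Y x *m frame v x = v x.
Proof.
move=> d0; rewrite /frame -scalemxAr mulmxA mul_mx_adj mul_scalar_mx scalerA.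
by rewrite mulVf// scale1r.
Qed.

(** The derivative of Cramer's formula is never computed. The determinant stays nonzero near [x], so
    [Y] times the frame equals [v] there, and uniqueness of the derivative gives the product rule
    identity. *)
Local Lemma der_frame v v1 x : vder v x v1 -> \det (Y x) != 0 ->
  exists z1, vder (frame v) x z1 /\ v1 = Y1 x *m frame v x + Y x *m z1.
Proof.
move=> hv d0; have dYx i j : exists d, der (fun t => Y t i j) x d by exists (Y1 x i j); exact: dY.
have [d hd] := der_det Y x dYx.
have /choice[e he] (p : 'I_n * 'I_n) : exists d, der (fun t => (\adj (Y t)) p.1 p.2) x d.
  exact: der_adj.
have hadj : mder (fun t => \adj (Y t)) x (\matrix_(i, j) e (i, j)).
  by move=> i j; rewrite mxE; exact: (he (i, j)).
have dinv : der (fun t => (\det (Y t))^-1) x (- (\det (Y x)) ^- 2 *: d).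
  exact: is_deriveV.
have hz := vderZ _ _ _ _ _ dinv (mder_mulmx _ _ _ _ _ hadj hv).
eexists; split; first exact: hz.
set z1 := (X in Y x *m X).
have hYz := mder_mulmx _ _ _ _ _ (dY x) hz.
apply/matrixP => i j; rewrite ord1.
apply: der_uniq (hv i) _; apply: der_near (hYz i).
have [r r0 hr] := near_dist _ x `|\det (Y x)| (der_cont _ _ _ hd) ltac:(by rewrite normr_gt0).
apply: (near_ball _ _ r) => // y /hr hy.
rewrite -/(frame v y) frameK//.
by apply: contraTneq hy => ->; rewrite sub0r normrN ltxx.
Qed.

(** Completion of the square: with [q = Y1 Y^-1 v], the derivative of [e^(c x) v.q] is the density
    of [v] minus [e^(c x) |v1 - q|^2]. *)
Lemma riccati_comparison s t v G : s <= t ->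
  (forall x, s <= x <= t -> \det (Y x) != 0) -> energy_majorant lam s t v G ->
  expR (c * t) * dot (v t) (Y1 t *m frame v t) -
  expR (c * s) * dot (v s) (Y1 s *m frame v s) <= G t - G s.
Proof.
move=> st hdet [v1 [G1 [M hG]]].
have /choice[z1 hz1] (x : R) : exists z1, s <= x <= t ->
    vder (frame v) x z1 /\ v1 x = Y1 x *m frame v x + Y x *m z1.
  have [hx|/negP hx] := boolP (s <= x <= t); last by exists 0.
  have [hv _ _ _] := hG x hx.
  by have [z1 hz] := der_frame v _ x hv (hdet x hx); exists z1.
pose q x := Y1 x *m frame v x.
apply: (der_mono_le (fun x => expR (c * x) * dot (v x) (q x))
  (fun x => expR (c * x) * (2 * dot (v1 x) (q x) - dot (q x) (q x)
     - dot (v x) (B x *m v x) + lam * dot (v x) (v x))) G G1) => // x hx.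
- have [hv _ _ _] := hG x hx; have [hz e] := hz1 x hx.
  have hq := mder_mulmx _ _ _ _ _ (dY1 x) hz.
  apply: der_eq (derM _ _ _ _ _ (der_expM c x) (vder_dot _ _ _ _ _ hv hq)) _.
  (* The Wronskian identity is applied to the two solutions [Y u] with [u] frozen at [frame v x] and
     at [z1 x]; it trades the unknown [z1] for [v1] and [q]. *)
  have sw : dot (v x) (Y1 x *m z1 x) = dot (q x) (v1 x) - dot (q x) (q x).
    have := wronskian lam _ _ _ _ a (fundamental_solution (frame v x)) (fundamental_solution (z1 x)).
    rewrite Ya !mul0mx => /(_ erefl erefl x).
    rewrite frameK ?hdet// => ->.
    by rewrite e -/(q x) dotDr; ring.
  rewrite !mulmxDl !mulNmx -!scalemxAl -mulmxA frameK ?hdet// -/(q x) !dotE sw.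
  by rewrite (dotC (q x) (v1 x)); ring.
- by have [_ hGx _ _] := hG x hx.
- have [_ _ hd _] := hG x hx; apply: le_trans hd; rewrite /density.
  rewrite ler_wpM2l ?expR_ge0// !lerD2r.
  have := dot_ge0 (v1 x - q x); rewrite !dotE (dotC (q x) (v1 x)); lra.
Qed.

End Riccati.

(** If no solution vanishing at [a] vanished again, [Y] would be invertible on all of []a, +oo[].
    The boundary terms of the two Riccati comparisons would cancel at [s1], where the pieces agree,
    and vanish at [s0] and [s2], so the energy could not be negative. *)
Lemma conjugate_point lam : negative_index lam -> exists s0, forall a, a < s0 ->
  exists t f f1, [/\ a < t, solution c B lam f f1, f a = 0, f t = 0 & f1 a != 0].
Proof.
move=> [s0 [s1 [s2 [v [w [G [H [/andP[s01 s12] hG hH [v0 vw w0] neg]]]]]]]].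
exists s0 => a as0; apply: contrapT => hn.
have [Y [Y1 [Ya Y1a dY dY1]]] := fundamental_matrix lam a.
have hdet x : a < x -> \det (Y x) != 0.
  move=> ax; apply/negP => /eqP d0; apply: hn.
  (* A kernel vector of [Y x] selects a combination of the columns of [Y] that vanishes at [a] and
     at [x]. *)
  have : ~~ (row_free (Y x)^T) by rewrite row_free_unit unitmx_tr unitmxE d0 unitr0.
  rewrite -kermx_eq0 => /rowV0Pn[u /sub_kermxP hu u0].
  exists x, (fun x => Y x *m u^T), (fun x => Y1 x *m u^T); split => //.
  - exact: fundamental_solution.
  - by rewrite Ya mul0mx.
  - by apply: trmx_inj; rewrite trmx_mul trmxK hu trmx0.
  - by rewrite Y1a mul1mx; apply: contra_neq u0 => e; apply: trmx_inj; rewrite e trmx0.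
have h1 := riccati_comparison lam a Y Y1 Ya dY dY1 s0 s1 v G (ltW s01)
  (fun x hx => hdet x (lt_le_trans as0 (proj1 (andP hx)))) hG.
have as1 := lt_trans as0 s01.
have h2 := riccati_comparison lam a Y Y1 Ya dY dY1 s1 s2 w H (ltW s12)
  (fun x hx => hdet x (lt_le_trans as1 (proj1 (andP hx)))) hH.
move: h1 h2; rewrite v0 w0 !dot0l !mulr0 /frame vw; lra.
Qed.

End Jacobi.

(** * Trial functions *)

Section Corner.
Context {R : realType} {n : nat}.
Variables (c : R) (B : R -> 'M[R]_n) (K : R).
Hypotheses (K0 : 0 < K)
  (B_form : forall x u v, `|dot u (B x *m v)| <= K * (dot u u + dot v v)).
Implicit Types (lam : R).

Lemma cvg_diff_quotient (g : R -> R) d : der g 0 d -> g 0 = 0 ->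
  s^-1 * g s @[s --> 0^'+] --> d.
Proof.
move=> [hd e] g0.
have H : h^-1 *: ((g \o shift 0) (h *: 1) - g 0) @[h --> (0 : R)^'] --> d.
  by move: hd; rewrite -e.
rewrite (_ : (fun s => s^-1 * g s) = (fun h => h^-1 *: ((g \o shift 0) (h *: 1) - g 0))).
  exact: cvg_dnbhs_at_right H.
by apply/funext => h; rewrite /= [h *: 1]mulr1 addr0 g0 subr0.
Qed.

(** This is the energy left when [f] is cut at [b - s] and joined to 0 by a linear ramp ending at
    [b + s]. Divided by [s], it tends to [e^(c b) (- D + D / 2)]. A ramp ending at [b] would only
    give [- D + D], hence the length [2 s]. *)
Lemma corner_energy lam f f1 b (D := dot (f1 b) (f1 b)) : solution c B lam f f1 ->
  f b = 0 -> f1 b != 0 ->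
  exists2 s, 0 < s &
    expR (c * (b - s)) * dot (f1 (b - s)) (f (b - s)) +
    expR (c * (b + s)) * dot (f (b - s)) (f (b - s)) *
      ((2 * s)^-1 + 2 * s * (2 * K + `|lam|)) < 0.
Proof.
move=> hf fb f1b; have D0 : 0 < D by exact: dot_gt0.
pose k := 2 * K + `|lam|.
have dneg (g : R -> R) d : der g b d -> der (fun s => g (b - s)) 0 (- d).
  move=> hg; apply: der_eq (der_comp g (fun s => b - s) 0 d (-1) _ _) _.
  - by rewrite subr0.
  - by apply: der_eq (derB _ _ _ _ _ (der_cst b 0) (der_id 0)) _; rewrite sub0r.
  - by rewrite mulrN1.
have [h1 h2] := hf b.
have c1 : s^-1 * dot (f1 (b - s)) (f (b - s)) @[s --> 0^'+] --> - D.
  apply: (cvg_diff_quotient (fun s => dot (f1 (b - s)) (f (b - s)))).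
    apply: (dneg (fun x => dot (f1 x) (f x))).
    by apply: der_eq (vder_dot _ _ _ _ _ h2 h1) _; rewrite fb dot0r add0r.
  by rewrite subr0 fb dot0r.
have c2 : s^-1 * s^-1 * dot (f (b - s)) (f (b - s)) @[s --> 0^'+] --> D.
  have ci i : s^-1 * f (b - s) i 0 @[s --> 0^'+] --> - (f1 b i 0).
    apply: (cvg_diff_quotient (fun s => f (b - s) i 0)).
      exact: (dneg (fun x => f x i 0)).
    by rewrite subr0 fb mxE.
  rewrite /D /dot (eq_bigr (fun i => - (f1 b i 0) * - (f1 b i 0))); last by move=> i _; rewrite mulrNN.
  under eq_fun do rewrite mulr_sumr.
  apply: cvg_sumr => i _; under eq_fun do rewrite mulrACA.
  exact: cvgM.
have ce (g : R -> R) d : der g 0 d -> g s @[s --> 0^'+] --> g 0.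
  by move=> hg; apply: cvg_at_right_filter; exact: (der_cont _ _ _ hg).
have c3 : expR (c * (b - s)) @[s --> 0^'+] --> expR (c * b).
  rewrite -[in X in _ --> X](subr0 b); apply: (ce (fun s => expR (c * (b - s))) _).
  by apply: der_comp (is_derive_expR _) (derZ c _ _ _ (derB _ _ _ _ _ (der_cst b 0) (der_id 0))).
have c4 : expR (c * (b + s)) @[s --> 0^'+] --> expR (c * b).
  rewrite -[in X in _ --> X](addr0 b); apply: (ce (fun s => expR (c * (b + s))) _).
  by apply: der_comp (is_derive_expR _) (derZ c _ _ _ (derD _ _ _ _ _ (der_cst b 0) (der_id 0))).
have c5 : 2^-1 + 2 * s * s * k @[s --> 0^'+] --> 2^-1 + 2 * 0 * 0 * k.
  apply: (ce (fun s => 2^-1 + 2 * s * s * k) _).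
  apply: derD; first exact: der_cst.
  apply: derM; last exact: der_cst.
  apply: derM; last exact: der_id.
  exact: derZ (der_id _).
have cc : expR (c * (b - s)) * (s^-1 * dot (f1 (b - s)) (f (b - s))) +
    expR (c * (b + s)) * (s^-1 * s^-1 * dot (f (b - s)) (f (b - s))) *
    (2^-1 + 2 * s * s * k) @[s --> 0^'+] -->
    expR (c * b) * - D + expR (c * b) * D * (2^-1 + 2 * 0 * 0 * k).
  by apply: cvgD; [exact: cvgM c3 c1|apply: cvgM c5; exact: cvgM c4 c2].
have lneg : expR (c * b) * - D + expR (c * b) * D * (2^-1 + 2 * 0 * 0 * k) < 0.
  rewrite mulr0 !mul0r addr0 -mulrA -mulrDr pmulr_rlt0 ?expR_gt0//; lra.
have := cvgr_lt _ cc _ lneg => hneg.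
have pos : \forall s \near 0^'+, (0 : R) < s by exact: nbhs_right_gt.
have [s [/= s0 hs]] := filter_ex (filterI pos (hneg _)).
exists s => //; rewrite -/k.
set X := (X in X < 0) in hs; set Y := (X in X < 0).
have -> : Y = s * X by rewrite /X /Y; field; rewrite gt_eqF.
by rewrite pmulr_rlt0.
Qed.

(** On the left, [f] is multiplied by a linear cut-off [chi] of length [r], at a cost of at most
    [e^(c b) M / r] since [c >= 0] bounds the weight there. For [r] large the negative corner energy
    prevails. *)
Lemma corner_negative_index lam f f1 b M : 0 <= c -> solution c B lam f f1 ->
  (forall x, x <= b -> dot (f x) (f x) <= M) ->
  f b = 0 -> f1 b != 0 -> negative_index c B lam.
Proof.
move=> c0 hf hM fb f1b.
have [s s0 neg] := corner_energy lam f f1 b hf fb f1b.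
set Y := (X in X < 0) in neg.
have M0 : 0 <= M by apply: le_trans (hM b (lexx _)); exact: dot_ge0.
have e0 := expR_gt0 (c * b).
(* Long enough for the cost of the cut-off to stay below the gain [- Y]; the final [+ 1] ensures
   that [r] is positive. *)
pose r := (1 + expR (c * b) * M) / (- Y) + 1.
have r0 : 0 < r.
  rewrite /r ltr_wpDl// divr_ge0 ?oppr_ge0 ?(ltW neg)//.
  by rewrite addr_ge0// mulr_ge0// ltW.
have rY : expR (c * b) * M / r < - Y.
  rewrite ltr_pdivrMr//.
  have -> : - Y * r = 1 + expR (c * b) * M - Y by rewrite /r; field; rewrite lt_eqF.
  by have := neg; lra.
pose s1 := b - s; pose s0' := s1 - r; pose s2 := b + s.
pose chi x := (x - s0') / r.
pose p := f s1.
pose k := 2 * K + `|lam|.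
have dchi x : der chi x r^-1.
  apply: der_eq (derM _ _ _ _ _ (derB _ _ _ _ _ (der_id x) (der_cst s0' x)) (der_cst r^-1 x)) _.
  by ring.
pose eta x := (s2 - x) / (2 * s).
have deta x : der eta x (- (2 * s)^-1).
  apply: der_eq (derM _ _ _ _ _ (derB _ _ _ _ _ (der_cst s2 x) (der_id x)) (der_cst (2 * s)^-1 x)) _.
  by ring.
(* Since [f] solves the equation, the density of [chi *: f] is the derivative of
   [e^(c x) chi^2 f1.f] plus [e^(c x) |f|^2 / r^2], and the last term is bounded by a constant. On
   the ramp the whole density is bounded by a constant, [k] accounting for [B] and [lam]. *)
exists s0', s1, s2, (fun x => chi x *: f x), (fun x => eta x *: p),
  (fun x => expR (c * x) * (chi x * chi x * dot (f1 x) (f x)) + expR (c * b) * M / (r * r) * x),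
  (fun x => expR (c * s2) * dot p p * ((2 * s)^-1 * (2 * s)^-1 + k) * x).
have chi0 : chi s0' = 0 by rewrite /chi subrr mul0r.
have chi1 : chi s1 = 1.
  by rewrite /chi /s0' opprB addrC subrK divff// gt_eqF.
split.
- by rewrite /s0' /s1 /s2; apply/andP; split; lra.
- exists (fun x => r^-1 *: f x + chi x *: f1 x),
    (fun x => expR (c * x) * (2 * chi x / r * dot (f1 x) (f x) +
       chi x * chi x * (dot (f1 x) (f1 x) - dot (f x) (B x *m f x) + lam * dot (f x) (f x)))
       + expR (c * b) * M / (r * r)), M => x /andP[hx1 hx2].
  have xb : x <= b by apply: (le_trans hx2); rewrite /s1; lra.
  have [h1 h2] := hf x.
  split.
  + exact: vderZ.
  + have d1 := derM _ _ _ _ _ (der_expM c x) (derM _ _ _ _ _ (derM _ _ _ _ _ (dchi x) (dchi x))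
      (vder_dot _ _ _ _ _ h2 h1)).
    apply: der_eq (derD _ _ _ _ _ d1 (derZ _ _ _ _ (der_id x))) _.
    rewrite !dotE (dotC (B x *m f x)); ring.
  + rewrite /density -scalemxAr !dotE (dotC (f x) (f1 x)).
    have h3 : expR (c * x) * (r^-1 * r^-1 * dot (f x) (f x)) <= expR (c * b) * M / (r * r).
      rewrite -[_ * M / _]mulrA ler_pM ?expR_ge0//.
      * by rewrite !mulr_ge0 ?dot_ge0// invr_ge0 ltW.
      * by rewrite ler_expR ler_wpM2l.
      * rewrite invfM mulrC ler_wpM2r ?hM//.
        by rewrite mulr_ge0// invr_ge0 ltW.
    lra.
  + rewrite !dotE; apply: le_trans (hM x xb).
    have ch0 : 0 <= chi x by rewrite divr_ge0 ?(ltW r0)// subr_ge0.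
    have ch1 : chi x <= 1 by rewrite ler_pdivrMr// mul1r /s0'; lra.
    by rewrite mulrA ler_piMl ?dot_ge0// mulr_ile1.
- exists (fun=> - (2 * s)^-1 *: p), (fun=> expR (c * s2) * dot p p * ((2 * s)^-1 * (2 * s)^-1 + k)),
    (dot p p) => x /andP[hx1 hx2].
  have et0 : 0 <= eta x by rewrite divr_ge0 ?subr_ge0// mulr_ge0 ?ltW.
  have et1 : eta x <= 1 by rewrite ler_pdivrMr ?mulr_gt0// mul1r; move: hx1; rewrite /s1 /s2; lra.
  have pp := dot_ge0 p.
  have ee : eta x * eta x * dot p p <= dot p p by rewrite ler_piMl// mulr_ile1.
  split.
  + apply: vder_eq (vderZ _ _ _ _ _ (deta x) (vder_cst p x)) _.
    by rewrite scaler0 addr0.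
  + by apply: der_eq (derZ _ _ _ _ (der_id x)) _; rewrite mulr1.
  + rewrite /density -scalemxAr !dotE -mulrA.
    have hk : (eta x * (eta x * (dot p p *+ 2 * K)) + `|lam| * (eta x * (eta x * dot p p)) <= dot p p * k).
      rewrite /k -mulr_natl; have := normr_ge0 lam; have := K0.
      have := ee; rewrite -subr_ge0 => e1 k1 l1.
      have : 0 <= (dot p p - eta x * eta x * dot p p) * (2 * K + `|lam|) by rewrite mulr_ge0//; lra.
      lra.
    have hB : `|dot p (B x *m p)| <= dot p p *+ 2 * K.
      by have := B_form x p p; rewrite -mulr2n mulrC.
    have hl : lam <= `|lam| by exact: ler_norm.
    have e1 : 0 <= eta x * eta x by rewrite mulr_ge0.
    have h4 : - (eta x * (eta x * dot p (B x *m p))) <= eta x * (eta x * (dot p p *+ 2 * K)).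
      have : 0 <= eta x * eta x * (dot p (B x *m p) + dot p p *+ 2 * K).
        by rewrite mulr_ge0//; move: hB; rewrite ler_norml; lra.
      by lra.
    have h5 : lam * (eta x * (eta x * dot p p)) <= `|lam| * (eta x * (eta x * dot p p)).
      by rewrite ler_wpM2r// mulrA mulr_ge0.
    have i0 : 0 <= (2 * s)^-1 by rewrite invr_ge0 mulr_ge0// ltW.
    apply: (@le_trans _ _ (expR (c * x) * (dot p p * ((2 * s)^-1 * (2 * s)^-1 + k)))).
      rewrite ler_wpM2l ?expR_ge0//; lra.
    rewrite ler_wpM2r//.
      have k0 : 0 <= k by rewrite /k; have := normr_ge0 lam; have := K0; lra.
      by rewrite mulr_ge0// addr_ge0// mulr_ge0.
    by rewrite ler_expR ler_wpM2l.
  + by rewrite !dotE mulrA.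
- split.
  + by rewrite chi0 scale0r.
  + rewrite chi1 scale1r /eta (_ : (s2 - s1) / (2 * s) = 1) ?scale1r//.
    by rewrite /s2 /s1; field; rewrite gt_eqF.
  + by rewrite /eta subrr mul0r scale0r.
- rewrite chi0 chi1 -!mulrBr.
  set Z := (X in X < 0).
  have -> : Z = expR (c * b) * M / r + Y.
    rewrite /Z /Y /s0' -/s1 -/s2 -/p -/k /s2 /s1; field.
    by rewrite !gt_eqF.
  by have := rY; lra.
Qed.

(** Raising [lam] by [e] adds to the energy at most [e] times a bound for the weighted square
    integral of the trial function. The bound on [dot (v x) (v x)] in [energy_majorant] is there for
    this purpose. *)
Lemma negative_index_raise lam : negative_index c B lam ->
  exists2 e, 0 < e & negative_index c B (lam + e).
Proof.
move=> [s0 [s1 [s2 [v [w [G [H [/andP[s01 s12] [v1 [G1 [M hG]]] [w1 [H1 [N hH]]] bd neg]]]]]]]].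
pose E := expR (`|c| * (`|s0| + `|s2|)).
have hE x : s0 <= x <= s2 -> expR (c * x) <= E.
  move=> /andP[x0 x2]; rewrite ler_expR; apply: (le_trans (ler_norm _)).
  rewrite normrM ler_wpM2l// ler_norml.
  have := ler_norm s2; have := lerNnormlW (lexx `|s0|); have := normr_ge0 s0; have := normr_ge0 s2.
  lra.
have E0 : 0 < E by exact: expR_gt0.
have M0 : 0 <= M.
  have [_ _ _] := hG s0 (introT andP (conj (lexx _) (ltW s01))).
  by apply: le_trans; exact: dot_ge0.
have N0 : 0 <= N.
  have [_ _ _] := hH s2 (introT andP (conj (ltW s12) (lexx _))).
  by apply: le_trans; exact: dot_ge0.
set S := (X in X < 0) in neg.
pose D := 1 + E * M * (s1 - s0) + E * N * (s2 - s1).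
have D0 : 0 < D.
  rewrite /D -addrA ltr_pwDl// addr_ge0// mulr_ge0 ?subr_ge0 ?(ltW s01) ?(ltW s12)//;
  by rewrite mulr_ge0// ltW.
pose e := - S / (2 * D).
have e0 : 0 < e by rewrite divr_gt0 ?mulr_gt0// oppr_gt0.
have raise u u1 x J P : s0 <= x <= s2 -> density c B lam u u1 x <= J -> dot (u x) (u x) <= P ->
    density c B (lam + e) u u1 x <= J + e * (E * P).
  move=> /hE hx hJ hP; have : e * (expR (c * x) * dot (u x) (u x)) <= e * (E * P).
    by rewrite ler_wpM2l ?(ltW e0)// ler_pM ?expR_ge0 ?dot_ge0.
  by move: hJ; rewrite /density; lra.
exists e => //; exists s0, s1, s2, v, w, (fun x => G x + e * (E * M) * x), (fun x => H x + e * (E * N) * x).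
split => //.
- by rewrite s01.
- exists v1, (fun x => G1 x + e * (E * M)), M => x hx.
  have [a1 a2 a3 a4] := hG x hx; split => //.
    by apply: der_eq (derD _ _ _ _ _ a2 (derZ _ _ _ _ (der_id x))) _; rewrite mulr1.
  by apply: raise => //; have /andP[-> /le_trans] := hx; apply; exact: ltW.
- exists w1, (fun x => H1 x + e * (E * N)), N => x hx.
  have [a1 a2 a3 a4] := hH x hx; split => //.
    by apply: der_eq (derD _ _ _ _ _ a2 (derZ _ _ _ _ (der_id x))) _; rewrite mulr1.
  apply: raise => //; have /andP[x1 ->] := hx; rewrite andbT; apply: le_trans x1; exact: ltW.
- set Z := (X in X < 0); have -> : Z = S + e * (D - 1) by rewrite /Z /S /D; ring.
  have : e * D = - S / 2 by rewrite /e; field; rewrite gt_eqF.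
  by have := e0; have := neg; rewrite mulrBr mulr1; lra.
Qed.

(** For [lam > 2 K] the density is nonnegative, as [|v.Bv| <= 2 K |v|^2]. *)
Lemma negative_index_bounded lam : negative_index c B lam -> lam <= 2 * K.
Proof.
move=> [s0 [s1 [s2 [v [w [G [H [/andP[s01 s12] [v1 [G1 [M hG]]] [w1 [H1 [N hH]]] bd neg]]]]]]]].
rewrite leNgt; apply/negP => hl.
have pos u u1 x : 0 <= density c B lam u u1 x.
  rewrite /density mulr_ge0 ?expR_ge0//.
  have := B_form x (u x) (u x); have := dot_ge0 (u x); have := dot_ge0 (u1 x).
  by rewrite ler_norml => a1 a2 a3; nra.
have g1 : G s0 <= G s1.
  apply: (der_mono _ G1) (ltW s01) _ _ => x /hG[_ h1 h2 _] //.
  exact: le_trans h2.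
have g2 : H s1 <= H s2.
  apply: (der_mono _ H1) (ltW s12) _ _ => x /hH[_ h1 h2 _] //.
  exact: le_trans h2.
lra.
Qed.

End Corner.

(** * Compactness *)

Section UltraLimits.
Context {R : realType}.

(** Replaces the extraction of subsequences: along one ultrafilter all bounded sequences converge
    simultaneously. *)
Lemma ultra_bounded_cvg (T : Type) (U : set_system T) (s : T -> R) (M : R) :
  UltraFilter U -> (\forall k \near U, `|s k| <= M) ->
  exists l : R, s k @[k --> U] --> l.
Proof.
move=> UU hs.
have hK : (s @ U) [set` `[- M, M]].
  by apply: filterS hs => k /=; rewrite in_itv /= ler_norml.
have [l [_ hl]] := @segment_compact R (- M) M (s @ U) _ hK.
exists l => V hV; have [//|hC] := in_ultra_setVsetC (s @^-1` V) UU.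
by have [x [nV Vx]] := hl (~` V) V hC hV.
Qed.

End UltraLimits.

Section VectorLimits.
Context {R : realType} {n : nat} {T : Type} {U : set_system T} {FU : Filter U}.

Lemma cvg_dot (f g : T -> 'cV[R]_n) (u v : 'cV[R]_n) :
  (forall i, f k i 0 @[k --> U] --> u i 0) -> (forall i, g k i 0 @[k --> U] --> v i 0) ->
  dot (f k) (g k) @[k --> U] --> dot u v.
Proof. by move=> hf hg; apply: cvg_sumr => i _; exact: cvgM. Qed.

End VectorLimits.

(** * Uniform bounds for solutions vanishing at two points *)

Section Core.
Context {R : realType} {n : nat}.
Variables (c : R) (B : R -> 'M[R]_n) (K b M0 : R).
Hypotheses (K0 : 0 < K)
  (B_form : forall x u v, `|dot u (B x *m v)| <= K * (dot u u + dot v v))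
  (B_sym : forall x u v, dot u (B x *m v) = dot (B x *m u) v)
  (B_cont : forall i j, continuous (fun x => B x i j))
  (B_bound : forall x i j, `|B x i j| <= b)
  (M00 : 0 < M0)
  (B_neg : forall x u, M0 <= `|x| -> dot u (B x *m u) <= 0).
Implicit Types (lam : R).

Lemma dot_square_le (u v : 'cV[R]_n) : dot u u <= 2 * dot v v + 2 * dot (u - v) (u - v).
Proof.
have := dot_ge0 (u - 2 *: v).
by rewrite !dotE (dotC v u); lra.
Qed.

(** The derivative of [e^(c x) f.f1] is [e^(c x) (|f1|^2 - f.Bf + lam |f|^2)], nonnegative where [B]
    is. This weighted convexity of [|f|^2] is the substitute for a maximum principle outside
    [[- M0, M0]]. *)
Lemma solution_square_convex lam f f1 x y : 0 <= lam -> solution c B lam f f1 ->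
  x <= y -> (y <= - M0) || (M0 <= x) ->
  expR (c * x) * dot (f x) (f1 x) <= expR (c * y) * dot (f y) (f1 y).
Proof.
move=> lam0 hf xy hM.
apply: (der_mono (fun x => expR (c * x) * dot (f x) (f1 x)) (fun x => expR (c * x) *
  (dot (f1 x) (f1 x) - dot (f x) (B x *m f x) + lam * dot (f x) (f x)))) => // z /andP[xz zy].
  have [h1 h2] := hf z.
  apply: der_eq (derM _ _ _ _ _ (der_expM c z) (vder_dot _ _ _ _ _ h1 h2)) _.
  by rewrite !dotE; ring.
rewrite mulr_ge0 ?expR_ge0//.
have Mz : M0 <= `|z|.
  case/orP: hM => h; first by rewrite ler0_norm; move: M00; lra.
  by rewrite ger0_norm; move: M00; lra.
have := B_neg z (f z) Mz; have := dot_ge0 (f1 z).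
have : 0 <= lam * dot (f z) (f z) by rewrite mulr_ge0 ?dot_ge0.
lra.
Qed.

Lemma solution_eq0_itv lam f f1 s t : solution c B lam f f1 -> s < t ->
  (forall x, s < x < t -> f x = 0) -> forall x, f x = 0 /\ f1 x = 0.
Proof.
move=> hf st h; pose m := (s + t) / 2.
have hm : s < m < t by rewrite /m; apply/andP; split; lra.
apply: (solution_eq0 c B K K0 B_form lam f f1 m hf (h m hm)).
apply/matrixP => i j; rewrite ord1 mxE.
have [h1 _] := hf m; apply: der_uniq (h1 i) _.
apply: der_near (der_cst 0 m); apply: (near_ball _ _ ((t - s) / 2)); first by lra.
move=> y; rewrite ltr_norml /m => hy; rewrite h ?mxE//.
by move: hy; lra.
Qed.

(** Left of [- M0], [f.f1] starts from 0 at [s], so [|f|^2] increases; right of [M0], it ends with 0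
    at [t], so [|f|^2] decreases. The bound thus reduces to [[- M0, M0]], where the energy at 0
    controls it. If [t] were at most [- M0], [|f|^2] would increase up to its zero at [t] and [f]
    would vanish identically. *)
Lemma conjugate_interval_bound lam L f f1 s t : 0 <= lam <= L -> solution c B lam f f1 ->
  s < t -> f s = 0 -> f t = 0 -> f1 s != 0 -> energy f f1 0 = 1 ->
  - M0 < t /\ forall x, s <= x <= t -> dot (f x) (f x) <= expR (growth c K L * M0).
Proof.
move=> /andP[lam0 lamL] hf st fs ft f1s e1.
have L0 : 0 <= L by exact: le_trans lamL.
have dq x : der (fun x => dot (f x) (f x)) x (2 * dot (f x) (f1 x)).
  have [h1 _] := hf x; apply: der_eq (vder_dot _ _ _ _ _ h1 h1) _.
  by rewrite (dotC (f1 x)); ring.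
have mid x : `|x| <= M0 -> dot (f x) (f x) <= expR (growth c K L * M0).
  move=> xM; have := solution_energy c B K K0 B_form lam L f f1 x 0.
  rewrite ger0_norm// => /(_ lamL hf); rewrite e1 mul1r subr0 => h.
  apply: (@le_trans _ _ (energy f f1 x)); first by rewrite lerDl dot_ge0.
  by apply: (le_trans h); rewrite ler_expR ler_wpM2l// ltW// growth_gt0.
have left x y : s <= x -> x <= y -> y <= - M0 -> dot (f x) (f x) <= dot (f y) (f y).
  move=> sx xy yM; apply: (der_mono (fun x => dot (f x) (f x)) (fun x => 2 * dot (f x) (f1 x))) => //.
  move=> z /andP[xz zy]; rewrite mulr_ge0//.
  have := solution_square_convex lam f f1 s z lam0 hf (le_trans sx xz).
  rewrite (le_trans zy yM) fs dot0l mulr0 => /(_ isT).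
  by rewrite pmulr_rge0// expR_gt0.
have right x : M0 <= x -> x <= t -> dot (f x) (f x) <= dot (f M0) (f M0).
  move=> Mx xt; rewrite -lerN2.
  apply: (der_mono (fun x => - dot (f x) (f x)) (fun x => - (2 * dot (f x) (f1 x)))) => // z /andP[Mz zx].
    exact: derN.
  rewrite oppr_ge0 pmulr_rle0//.
  have := solution_square_convex lam f f1 z t lam0 hf (le_trans zx xt).
  rewrite Mz orbT ft dot0l mulr0 => /(_ isT).
  by rewrite pmulr_rle0// expR_gt0.
have Mt : - M0 < t.
  rewrite ltNge; apply/negP => tM.
  have [] := solution_eq0_itv lam f f1 s t hf st _ s.
    move=> x /andP[/ltW sx /ltW xt]; apply: dot_eq0; apply/eqP.
    by rewrite eq_le dot_ge0 andbT (le_trans (left x t sx xt tM))// ft dot0l.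
  by move=> _ /eqP; rewrite (negPf f1s).
split => // x /andP[sx xt].
have [xM|Mx] := leP x (- M0).
  by apply: (le_trans (left _ _ sx xM (lexx _))); rewrite mid// normrN gtr0_norm.
have [xM|{}Mx'] := leP x M0; first by rewrite mid// ler_norml xM ltW.
by apply: (le_trans (right _ (ltW Mx') xt)); rewrite mid// gtr0_norm.
Qed.

(** Continuous dependence on the spectral parameter: [g - f] solves the equation for [mu] with
    forcing term [(mu - lam) f]. *)
Lemma solution_perturbation lam L mu f f1 g g1 N x : `|lam| <= L -> `|mu| <= L ->
  solution c B lam f f1 -> solution c B mu g g1 -> `|x| <= N ->
  energy (fun x => g x - f x) (fun x => g1 x - f1 x) x <=
  (energy (fun x => g x - f x) (fun x => g1 x - f1 x) 0 +
   (mu - lam) ^+ 2 * (energy f f1 0 * expR (growth c K L * N)) / growth c K L) * expR (growth c K L * N).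
Proof.
move=> lamL muL hf hg xN.
have C0 : 0 < growth c K L by apply: growth_gt0 => //; exact: le_trans lamL.
have ee y : `|y| <= N -> expR (growth c K L * `|y|) <= expR (growth c K L * N).
  by move=> yN; rewrite ler_expR ler_wpM2l// ltW.
have := energy_bound c B K K0 B_form mu L
  ((mu - lam) ^+ 2 * (energy f f1 0 * expR (growth c K L * N)))
  (fun x => g x - f x) (fun x => g1 x - f1 x) (fun x => (mu - lam) *: f x) x 0 muL.
rewrite subr0 => /(_ _ _)/wrap[y|y|h].
- have [h1 h2] := hf y; have [h3 h4] := hg y.
  have hN1 (u u1 : R -> 'cV[R]_n) v v1 : vder u y v -> vder u1 y v1 -> vder (fun t => u t - u1 t) y (v - v1).
    move=> a1 a2; rewrite -[- v1]scaleN1r; apply: (vder_ext (fun t => u t + (-1) *: u1 t)).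
      by move=> t; rewrite scaleN1r.
    by apply: vderD => //; exact: vderZc.
  split; first exact: hN1.
  apply: vder_eq (hN1 _ _ _ _ h4 h2) _.
  by rewrite mulmxBr; apply/matrixP => i j; rewrite !mxE; ring.
- rewrite subr0 => yx; rewrite !dotE mulrA -expr2 ler_wpM2l ?sqr_ge0//.
  have := solution_energy c B K K0 B_form lam L f f1 y 0 lamL hf; rewrite subr0 => hy.
  apply: (@le_trans _ _ (energy f f1 y)); first by rewrite lerDl dot_ge0.
  by apply: (le_trans hy); rewrite ler_wpM2l ?energy_ge0// ee// (le_trans yx).
apply: (le_trans h); rewrite ler_wpM2l ?ee// addr_ge0 ?energy_ge0//.
by rewrite divr_ge0 ?(ltW C0)// mulr_ge0 ?sqr_ge0// mulr_ge0 ?energy_ge0 ?expR_ge0.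
Qed.

End Core.

(** * Passage to the limit at the supremum *)

Section Existence.
Context {R : realType} {n : nat}.
Variables (c : R) (B : R -> 'M[R]_n) (K b M0 : R).
Hypotheses (K0 : 0 < K)
  (B_form : forall x u v, `|dot u (B x *m v)| <= K * (dot u u + dot v v))
  (B_sym : forall x u v, dot u (B x *m v) = dot (B x *m u) v)
  (B_cont : forall i j, continuous (fun x => B x i j))
  (B_bound : forall x i j, `|B x i j| <= b)
  (M00 : 0 < M0)
  (B_neg : forall x u, M0 <= `|x| -> dot u (B x *m u) <= 0).
Implicit Types (lam : R).

(** The energy is normalized at 0, not at [s], so that the normalization survives when [s] tends to
    [-oo]. *)
Lemma conjugate_interval_far lam N : negative_index c B lam ->
  exists s t f f1, [/\ s < N, s < t, solution c B lam f f1,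
    f s = 0 /\ f t = 0 & f1 s != 0 /\ energy f f1 0 = 1].
Proof.
move=> /(conjugate_point c B B_sym b B_cont B_bound)[s0 h].
pose s := Num.min s0 N - 1.
have hs : s < s0 /\ s < N by split; rewrite /s ltrBlDr gt_min ltrDl ltr01 ?orbT.
have [t [f [f1 [st hf fs ft f1s]]]] := h s (proj1 hs).
have e0 : 0 < energy f f1 0.
  rewrite lt_def energy_ge0 andbT; apply: contra_neq f1s => e.
  have f0 : f 0 = 0.
    by apply: dot_eq0; have := dot_ge0 (f 0); have := dot_ge0 (f1 0); move: e; rewrite /energy; lra.
  have f10 : f1 0 = 0.
    by apply: dot_eq0; have := dot_ge0 (f 0); have := dot_ge0 (f1 0); move: e; rewrite /energy; lra.
  by have [] := solution_eq0 c B K K0 B_form lam f f1 0 hf f0 f10 s.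
pose r := (Num.sqrt (energy f f1 0))^-1.
have r0 : 0 < r by rewrite invr_gt0 sqrtr_gt0.
exists s, t, (fun x => r *: f x), (fun x => r *: f1 x); split => //.
- exact: (proj2 hs).
- exact: solution_scale.
- by rewrite fs ft scaler0.
- split; first by rewrite scaler_eq0 negb_or gt_eqF.
  rewrite /energy !dotE -!mulrDr -/(energy f f1 0) mulrA -expr2 /r exprVn sqr_sqrtr ?(ltW e0)//.
  by rewrite mulVf// gt_eqF.
Qed.

Lemma bounded_solution_exists p p1 x0 M : 0 <= c -> solution c B 0 p p1 ->
  (forall x, dot (p x) (p x) <= M) -> p x0 = 0 -> p1 x0 != 0 ->
  exists lam f f1 M', [/\ 0 < lam, solution c B lam f f1,
    forall x, dot (f x) (f x) <= M' & energy f f1 0 = 1].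
Proof.
move=> c0 hp pM px0 p1x0.
(* [T] contains 0 because of the zero of [p], is bounded by [2 * K], and each of its points can be
   raised: its supremum is positive and not attained. *)
pose T := [set lam | 0 <= lam /\ negative_index c B lam].
have T0 : T 0.
  by split => //; apply: (corner_negative_index c B K K0 B_form 0 p p1 x0 M).
have Tsup : has_sup T.
  split; first by exists 0.
  by exists (2 * K) => lam [_ /(negative_index_bounded c B K B_form)].
pose ls := sup T.
have Tle lam : T lam -> lam <= ls by move=> Tl; apply: sup_upper_bound.
have Traise : ~ T ls.
  move=> [ls0 /(negative_index_raise c B)[e e0 he]].
  have : ls + e <= ls by apply: Tle; split => //; rewrite addr_ge0// ltW.
  lra.
have ls0 : 0 < ls.
  have [e e0 he] := negative_index_raise c B 0 (proj2 T0).
  by apply: (lt_le_trans e0); apply: Tle; split; [exact: ltW|rewrite add0r in he].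
have /choice[q hq] (k : nat) : exists q : R * R * R * (R -> 'cV[R]_n) * (R -> 'cV[R]_n),
    let: (lam, s, t, f, f1) := q in
    [/\ 0 <= lam <= ls, ls - k.+1%:R^-1 < lam, s < - k%:R & s < t] /\
    [/\ solution c B lam f f1, f s = 0 , f t = 0, f1 s != 0 & energy f f1 0 = 1].
  have k0 : (0 : R) < k.+1%:R^-1 by rewrite invr_gt0 ltr0n.
  have [lam [lam0 Tl] hl] := sup_adherent k0 Tsup.
  have [s [t [f [f1 [sk st hf [fs ft] [f1s e1]]]]]] := conjugate_interval_far lam (- k%:R) Tl.
  by exists (lam, s, t, f, f1); split; split => //; rewrite lam0 Tle.
pose lk k := (q k).1.1.1.1; pose sk k := (q k).1.1.1.2; pose tk k := (q k).1.1.2.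
pose fk k := (q k).1.2; pose fk1 k := (q k).2.
have {}hq k : [/\ 0 <= lk k <= ls, ls - k.+1%:R^-1 < lk k, sk k < - k%:R & sk k < tk k] /\
    [/\ solution c B (lk k) (fk k) (fk1 k), fk k (sk k) = 0 , fk k (tk k) = 0,
    fk1 k (sk k) != 0 & energy (fk k) (fk1 k) 0 = 1].
  by have := hq k; rewrite /lk /sk /tk /fk /fk1; case: (q k) => [[[[? ?] ?] ?] ?].
(* All [lk k] are bounded by [ls], so the resulting bound [K1] does not depend on [k]. *)
have {}hb k := conjugate_interval_bound c B K M0 K0 B_form M00 B_neg (lk k) ls (fk k) (fk1 k) (sk k) (tk k)
  (let: conj (And4 a _ _ _) _ := hq k in a)
  (let: conj _ (And5 a _ _ _ _) := hq k in a) (let: conj (And4 _ _ _ a) _ := hq k in a)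
  (let: conj _ (And5 _ a _ _ _) := hq k in a) (let: conj _ (And5 _ _ a _ _) := hq k in a)
  (let: conj _ (And5 _ _ _ a _) := hq k in a) (let: conj _ (And5 _ _ _ _ a) := hq k in a).
set K1 := expR _ in hb.
(* A single ultrafilter provides the limits of the initial data and, later, decides whether the
   right endpoints [tk] stay bounded. *)
have [U [UU hU]] := ultraFilterLemma (@eventually_filter).
have lkU : lk k @[k --> U] --> ls.
  apply/cvgrPdist_lt => e e0.
  apply: filterS (hU _ (near_infty_natSinv_lt (PosNum e0))) => k hk.
  have {}hk : k.+1%:R^-1 < e := hk.
  have [[/andP[_ l1] l2 _ _] _] := hq k.
  by rewrite ger0_norm ?subr_ge0//; apply: le_lt_trans hk; rewrite lerBlDr -lerBlDl ltW.
have dataU (g : nat -> 'cV[R]_n) : (forall k, dot (g k) (g k) <= 1) ->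
    exists u : 'cV[R]_n, forall i, g k i 0 @[k --> U] --> u i 0.
  move=> hg.
  have /choice[u hu] i : exists l : R, g k i 0 @[k --> U] --> l.
    apply: (ultra_bounded_cvg _ _ _ 1); apply: nearW => k.
    rewrite -(@expr_le1 _ 2)// real_normK ?num_real//.
    exact: le_trans (dot_coord _ _) (hg k).
  by exists (\col_i u i) => i; rewrite mxE.
have [u0 hu0] : exists u : 'cV[R]_n, forall i, fk k 0 i 0 @[k --> U] --> u i 0.
  by apply: dataU => k; have [_ [_ _ _ _ <-]] := hq k; rewrite lerDl dot_ge0.
have [u1 hu1] : exists u : 'cV[R]_n, forall i, fk1 k 0 i 0 @[k --> U] --> u i 0.
  by apply: dataU => k; have [_ [_ _ _ _ <-]] := hq k; rewrite lerDr dot_ge0.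
have [f [f1 [hf f0 f10]]] := solution_exists c B b B_cont B_bound ls 0 u0 u1.
pose Ed k := energy (fun x => fk k x - f x) (fun x => fk1 k x - f1 x).
have Ed0 : Ed k 0 @[k --> U] --> (0 : R).
  rewrite -[X in _ --> X](_ : dot (u0 - f 0) (u0 - f 0) + dot (u1 - f1 0) (u1 - f1 0) = 0); last first.
    by rewrite f0 f10 !subrr !dot0l addr0.
  by apply: cvgD; apply: cvg_dot => i; rewrite !mxE; under eq_fun do rewrite !mxE;
    apply: cvgB; (try exact: cvg_cst).
have E1 : energy f f1 0 = 1.
  have h1 : energy (fk k) (fk1 k) 0 @[k --> U] --> energy f f1 0.
    by rewrite /energy f0 f10; apply: cvgD; apply: cvg_dot.
  have h2 : energy (fk k) (fk1 k) 0 @[k --> U] --> (1 : R).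
    rewrite (_ : (fun k => _) = cst 1); first exact: cvg_cst.
    by apply/funext => k; have [_ [_ _ _ _ ->]] := hq k.
  exact: (cvg_unique _ h1 h2).
(* Continuous dependence turns convergence of the data at 0 into uniform convergence on bounded
   intervals, derivatives included. *)
have unif N e : 0 < e -> \forall k \near U, forall x, `|x| <= N -> Ed k x <= e.
  move=> e0; pose X := expR (growth c K ls * N).
  have hX : (Ed k 0 + (lk k - ls) ^+ 2 * (energy f f1 0 * X) / growth c K ls) * X @[k --> U] -->
      (0 + (ls - ls) ^+ 2 * (energy f f1 0 * X) / growth c K ls) * X.
    apply: cvgM; last exact: cvg_cst.
    apply: cvgD => //; apply: cvgM; last exact: cvg_cst.
    apply: cvgM; last exact: cvg_cst.
    by rewrite expr2; under eq_fun do rewrite expr2; apply: cvgM; apply: cvgB => //; exact: cvg_cst.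
  have lt : (0 + (ls - ls) ^+ 2 * (energy f f1 0 * X) / growth c K ls) * X < e.
    by rewrite subrr expr0n !mul0r addr0 mul0r.
  have := cvgr_lt _ hX _ lt => /(_ _); apply: filterS => k /ltW hk x xN.
  have [[/andP[l0 l1] _ _ _] [hfk _ _ _ _]] := hq k.
  have a1 : `|ls| <= ls by rewrite ger0_norm// ltW.
  have a2 : `|lk k| <= ls by rewrite ger0_norm.
  have := solution_perturbation c B K K0 B_form ls ls (lk k) f f1 (fk k) (fk1 k) N x a1 a2 hf hfk xN.
  by move=> /le_trans; apply.
have nearf x e : 0 < e -> \forall k \near U, dot (f x - fk k x) (f x - fk k x) <= e.
  move=> e0; apply: filterS (unif `|x| e e0) => k /(_ x (lexx _)).
  rewrite -opprB dotNl dotNr opprK; apply: le_trans.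
  by rewrite /Ed /energy lerDl dot_ge0.
(* For fixed [x] the left endpoint is eventually below [x], since [sk k < - k]. So only [x <= tk k]
   is needed for the uniform bound to pass to the limit, with an error of at most 1. *)
have bnd x : (\forall k \near U, x <= tk k) -> dot (f x) (f x) <= 2 * K1 + 2 * 1.
  move=> hx.
  have hs : \forall k \near U, sk k <= x.
    apply: filterS (hU _ (nbhs_infty_gtr (- x))) => k hk.
    by have [[_ _ h _] _] := hq k; move: h hk; lra.
  have [k [[h1 h2] h3]] := filter_ex (filterI (filterI hx hs) (nearf x 1 ltr01)).
  apply: (le_trans (dot_square_le _ (fk k x))); apply: lerD; rewrite ler_pM2l//.
  by have [_] := hb k; apply; rewrite h2.
(* If the [tk] are unbounded along [U], every [x] is eventually below them and [f] is bounded on the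
   line. Otherwise they converge to some [be], which is refuted below. *)
have [[N hN]|hT] := pselect (exists N, \forall k \near U, tk k <= N); last first.
  exists ls, f, f1, (2 * K1 + 2 * 1); split => // x; apply: bnd.
  have [h|h] := in_ultra_setVsetC [set k | x <= tk k] UU; first exact: h.
  exfalso; apply: hT; exists x; apply: filterS h => k /= /negP.
  by rewrite -ltNge => /ltW.
exfalso.
have [be hbe] : exists be : R, tk k @[k --> U] --> be.
  apply: (ultra_bounded_cvg _ _ _ (M0 + `|N|)); apply: filterS hN => k hk.
  have [h _] := hb k; have := ler_norm N; have := normr_ge0 N; have := M00.
  by rewrite ler_norml; lra.
(* [fk k] vanishes at [tk k]; uniform convergence and continuity carry the zero to the limit. *)
have fbe : f be = 0.
  apply: dot_eq0; apply/eqP; rewrite eq_le dot_ge0 andbT.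
  apply/ler_addgt0Pr => e e0; rewrite add0r.
  pose g x := dot (f be - f x) (f be - f x).
  have cg : {for be, continuous g}.
    have [h1 _] := hf be.
    have h2 : vder (fun x => f be - f x) be (0 - f1 be).
      rewrite -[- f1 be]scaleN1r; apply: (vder_ext (fun x => f be + (-1) *: f x)).
        by move=> x; rewrite scaleN1r.
      by apply: vderD; [exact: vder_cst|exact: vderZc].
    exact: der_cont (vder_dot _ _ _ _ _ h2 h2).
  have e4 : 0 < e / 4 by rewrite divr_gt0.
  have [d d0 hd] := near_dist g be (e / 4) cg e4.
  have n1 : \forall k \near U, `|tk k - be| < d.
    by move/cvgrPdist_lt: hbe => /(_ d d0); apply: filterS => k; rewrite distrC.
  have n2 := unif (`|be| + d) (e / 4) e4.
  have [k [h1 h2]] := filter_ex (filterI n1 n2).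
  apply: (le_trans (dot_square_le _ (f (tk k)))).
  have g1 : g (tk k) <= e / 4.
    by have := hd _ h1; rewrite /g subrr dot0l subr0 => /ltW/(le_trans (ler_norm _)).
  have g2 : dot (f (tk k)) (f (tk k)) <= e / 4.
    have : `|tk k| <= `|be| + d.
      by have := ler_normD (tk k - be) be; rewrite subrK; lra.
    move=> /h2; rewrite /Ed /energy; have [_ [_ _ -> _ _]] := hq k.
    rewrite sub0r dotNl dotNr opprK; apply: le_trans.
    by rewrite lerDl dot_ge0.
  by move: g1 g2; rewrite /g; lra.
(* The limit is bounded on the left of its zero [be] and nontrivial, so it yields a trial function
   at [ls] itself. *)
apply: Traise; split; first exact: ltW.
apply: (corner_negative_index c B K K0 B_form ls f f1 be (2 * K1 + 2 * 1) c0 hf _ fbe).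
  move=> x; rewrite le_eqVlt => /predU1P[->|xbe].
    by rewrite fbe dot0l; have := expR_ge0 (growth c K ls * M0); rewrite -/K1; lra.
  apply: bnd; have d0 : 0 < be - x by rewrite subr_gt0.
  move/cvgrPdist_lt: hbe => /(_ _ d0); apply: filterS => k.
  by rewrite ltr_norml; lra.
apply/eqP => f1be.
have [] := solution_eq0 c B K K0 B_form ls f f1 be hf fbe f1be 0.
by move: E1; rewrite /energy => /[swap] -> /[swap] ->; rewrite dot0l addr0 => /eqP; rewrite eq_sym oner_eq0.
Qed.

End Existence.

(** * Reflection and several variables *)

Section Reflection.
Context {R : realType} {n : nat}.
Variables (c : R) (B : R -> 'M[R]_n).

Lemma solution_reflect lam f f1 : solution c B lam f f1 ->
  solution (- c) (fun x => B (- x)) lam (fun x => f (- x)) (fun x => - f1 (- x)).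
Proof.
move=> hf x; have [h1 h2] := hf (- x).
have dN : der (fun y : R => - y) x (-1) := derN _ _ _ (der_id x).
split.
  by apply: vder_eq (vder_comp _ _ _ (fun y => - y) _ h1 dN) _; rewrite scaleN1r.
apply: (vder_ext (fun y => -1 *: f1 (- y))); first by move=> y; rewrite scaleN1r.
apply: vder_eq (vderZc _ _ _ (-1) (vder_comp _ _ _ (fun y => - y) _ h2 dN)) _.
by apply/matrixP => i j; rewrite !mxE; ring.
Qed.

End Reflection.

Lemma bounded_eigensolution (R : realType) (n : nat) (c : R) (B : R -> 'M[R]_n) (K b M0 : R)
  (p p1 : R -> 'cV[R]_n) (x0 M : R) : 0 < K ->
  (forall x u v, `|dot u (B x *m v)| <= K * (dot u u + dot v v)) ->
  (forall x u v, dot u (B x *m v) = dot (B x *m u) v) ->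
  (forall i j, continuous (fun x => B x i j)) ->
  (forall x i j, `|B x i j| <= b) ->
  0 < M0 -> (forall x u, M0 <= `|x| -> dot u (B x *m u) <= 0) ->
  solution c B 0 p p1 -> (forall x, dot (p x) (p x) <= M) -> p x0 = 0 -> p1 x0 != 0 ->
  exists lam f f1 M', [/\ 0 < lam, solution c B lam f f1,
    forall x, dot (f x) (f x) <= M' & energy f f1 0 = 1].
Proof.
move=> K0 BK Bs Bc Bb M00 Bn hp pM px0 p1x0.
have [c0|c0] := leP 0 c.
  exact: (bounded_solution_exists c B K b M0 K0 BK Bs Bc Bb M00 Bn p p1 x0 M).
have [|||||||lam [f [f1 [M' [l0 hf fM e1]]]]] :=
  bounded_solution_exists (- c) (fun x => B (- x)) K b M0 K0 (fun x => BK (- x))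
  (fun x => Bs (- x)) _ (fun x => Bb (- x)) M00 _ (fun x => p (- x)) (fun x => - p1 (- x)) (- x0) M.
- move=> i j x; apply: (continuous_comp (g := fun x => B x i j)); last exact: Bc.
  exact: (der_cont _ _ _ (derN _ _ _ (der_id x))).
- by move=> x u; rewrite -normrN; exact: Bn.
- by rewrite oppr_ge0 ltW.
- exact: solution_reflect.
- by move=> x; exact: pM.
- by rewrite opprK.
- by rewrite opprK oppr_eq0.
exists lam, (fun x => f (- x)), (fun x => - f1 (- x)), M'; split => //.
- have := solution_reflect _ _ _ _ _ hf; rewrite opprK.
  by rewrite (_ : (fun x => B (- - x)) = B)//; apply/funext => x; rewrite opprK.
- by rewrite /energy oppr0 dotNl dotNr opprK.
Qed.

(** * Chain rule and symmetry of second derivatives *)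

Section SeveralVariables.
Context {R : realType} {n : nat}.
Implicit Types (g F : 'cV[R]_n -> R) (u v : 'cV[R]_n).

Lemma near_dist_cV g v e : {for v, continuous g} -> 0 < e ->
  exists2 d, 0 < d & forall u, (forall i, `|u i 0 - v i 0| < d) -> `|g u - g v| < e.
Proof.
move=> /cvgrPdist_lt/(_ _)/[apply] /nbhs_ballP[d d0 h].
exists d => // u hu; rewrite distrC; apply: h; split => // i j; rewrite ord1.
by rewrite /ball /= distrC.
Qed.

Lemma der_line g v i s : (forall x, derivable g x (delta_mx i 0)) ->
  der (fun t => g (v + t *: delta_mx i 0)) s (partial i g (v + s *: delta_mx i 0)).
Proof.
move=> hg; set X := v + s *: delta_mx i 0.
have e : (fun h : R => h^-1 *: (((fun t => g (v + t *: delta_mx i 0)) \o shift s) (h *: 1) -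
    (fun t => g (v + t *: delta_mx i 0)) s)) =
  (fun h => h^-1 *: ((g \o shift X) (h *: delta_mx i 0) - g X)).
  apply/funext => h; rewrite /= /X [h *: 1]mulr1 scalerDl.
  by rewrite [h *: _ + (v + _)]addrCA.
split.
  by rewrite /derivable e; exact: hg.
by rewrite /partial /derive e.
Qed.

(** Pass from [v] to [u] one coordinate at a time, [P m] having the first [m] coordinates of [u],
    and apply the mean value theorem to each step. *)
Lemma classC1_increment g u v : classC1 g ->
  exists xi : 'I_n -> 'cV[R]_n,
    (forall k i, `|xi k i 0 - v i 0| <= `|u i 0 - v i 0|) /\
    g u - g v = \sum_k partial k g (xi k) * (u k 0 - v k 0).
Proof.
move=> hg.
pose P m : 'cV[R]_n := \col_i (if (i < m)%N then u i 0 else v i 0).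
have PS (k : 'I_n) : P k.+1 = P k + (u k 0 - v k 0) *: delta_mx k 0.
  apply/matrixP => i j; rewrite !mxE ord1 eqxx andbT ltnS leq_eqVlt.
  have [<-|ik] := eqVneq k i; first by rewrite ltnn eqxx /=; ring.
  rewrite [nat_of_ord i == k]eq_sym -[nat_of_ord k == i]/(k == i) (negPf ik) /=; ring.
have /choice[xi hxi] (k : 'I_n) : exists xi : 'cV[R]_n,
    (forall i, `|xi i 0 - v i 0| <= `|u i 0 - v i 0|) /\
    g (P k.+1) - g (P k) = partial k g xi * (u k 0 - v k 0).
  have [hd _] := hg k.
  pose d := u k 0 - v k 0.
  have dl t : der (fun t => g (P k + (t * d) *: delta_mx k 0)) t
      (partial k g (P k + (t * d) *: delta_mx k 0) * d).
    apply: (der_comp (fun s => g (P k + s *: delta_mx k 0)) (fun t => t * d)).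
      exact: der_line.
    by apply: der_eq (derM _ _ _ _ _ (der_id t) (der_cst d t)) _; ring.
  have [t /andP[t0 t1]] := der_mvt _ _ 0 1 ltr01 (fun t _ => dl t).
  rewrite mul1r mul0r scale0r addr0 subr0 mulr1 -PS => e.
  exists (P k + (t * d) *: delta_mx k 0); split => // i.
  rewrite !mxE eqxx andbT; have [->|ik] := eqVneq i k.
    rewrite ltnn mulr1 addrAC subrr add0r /d normrM ler_piMl//.
    by rewrite ger0_norm ltW.
  rewrite mulr0 addr0; case: ifP => // _; by rewrite subrr normr0.
exists xi; split; first by move=> k i; have [h _] := hxi k; exact: h.
have uP : u = P n by apply/matrixP => i j; rewrite mxE ord1 ltn_ord.
have vP : v = P 0%N by apply/matrixP => i j; rewrite mxE ord1.
have -> : g u - g v = g (P n) - g (P 0%N) by rewrite -uP -vP.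
rewrite -(telescope_sumr (fun m => g (P m)) (leq0n n)) big_mkord.
by apply: eq_bigr => k _; have [_ ->] := hxi k.
Qed.

(** As [h x = 0], the difference quotient of the product is [a] times that of [h]. In the chain rule
    [a] is a partial derivative at an intermediate point, known only to be continuous at [x]. *)
Lemma der_mul_cont (a h : R -> R) x d :
  {for x, continuous a} -> der h x d -> h x = 0 -> der (fun y => a y * h y) x (a x * d).
Proof.
move=> ca [hd e] h0.
have H : k^-1 *: ((h \o shift x) (k *: 1) - h x) @[k --> (0 : R)^'] --> d.
  by move: hd; rewrite -e.
have Ha : a (k + x) @[k --> (0 : R)^'] --> a x.
  apply/cvgrPdist_lt => e1 e10; have [r r0 hr] := near_dist a x e1 ca e10.
  apply: filterS (dnbhs0_lt r0) => k hk; rewrite distrC; apply: hr.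
  by rewrite addrK.
have := cvgM Ha H.
set G := (X in X @ _ --> _) => HG.
have eG : (fun k : R => k^-1 *: (((fun y => a y * h y) \o shift x) (k *: 1) - a x * h x)) = G.
  apply/funext => k; rewrite /G /GRing.scale /= h0 mulr0 !subr0 mulr1.
  by rewrite mulrCA.
split; first by rewrite /derivable eG; apply/cvg_ex; exists (a x * d); exact: HG.
rewrite /derive eG.
exact: (cvg_lim (@norm_hausdorff _ _) (HG _)).
Qed.

Lemma chain_rule g (w : R -> 'cV[R]_n) w1 x : classC1 g -> vder w x w1 ->
  der (fun t => g (w t)) x (\sum_k partial k g (w x) * w1 k 0).
Proof.
move=> hg hw.
have /choice[xi hxi] y := classC1_increment g (w y) (w x) hg.
have d1 : der (fun y => g (w y) - g (w x)) x (\sum_k partial k g (w x) * w1 k 0).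
  have e y : \sum_k partial k g (xi y k) * (w y k 0 - w x k 0) = g (w y) - g (w x).
    by have [_ ->] := hxi y.
  apply: (der_ext _ _ _ _ e); apply: der_sum => k _.
  have xix : xi x k = w x.
    apply/matrixP => i j; rewrite ord1; apply/eqP; rewrite -subr_eq0 -normr_le0.
    by have [/(_ k i) h _] := hxi x; move: h; rewrite subrr normr0.
  rewrite -[in partial k g (w x)]xix.
  apply: (der_mul_cont (fun y => partial k g (xi y k))); last by rewrite subrr.
    apply: dist_cont => e0 e00; rewrite xix.
    have [_ /(_ (w x)) ck] := hg k.
    have [d d0 hd] := near_dist_cV _ _ _ ck e00.
    have /choice[r hr] i : exists r, 0 < r /\ forall y, `|y - x| < r -> `|w y i 0 - w x i 0| < d.
      by have [r r0 hr] := near_dist _ x _ (der_cont _ _ _ (hw i)) d0; exists r.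
    have [ro ro0 rr] : exists2 ro : R, 0 < ro & forall i, ro <= r i.
      exists (\big[Num.min/1]_i r i).
        by elim/big_ind: _ => [//|a b a0 b0|i _]; [rewrite lt_min a0|have [] := hr i].
      by move=> i; rewrite (bigD1 i)//= ge_min lexx.
    exists ro => // y hy; apply: hd => i.
    have [/(_ k i) h _] := hxi y; apply: (le_lt_trans h).
    by have [_] := hr i; apply; exact: lt_le_trans (rr i).
  by apply: der_eq (derB _ _ _ _ _ (hw k) (der_cst (w x k 0) x)) _; rewrite subr0.
apply: (der_ext (fun y => (g (w y) - g (w x)) + g (w x))); first by move=> y; rewrite subrK.
by rewrite -[X in der _ _ X]addr0; apply: derD => //; exact: der_cst.
Qed.

Lemma second_difference F (x : 'cV[R]_n) i j (h : R) : classC2 F -> 0 < h ->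
  exists y : 'cV[R]_n, (forall k, `|y k 0 - x k 0| <= 2 * h) /\
    F (x + h *: delta_mx i 0 + h *: delta_mx j 0) - F (x + h *: delta_mx i 0)
     - (F (x + h *: delta_mx j 0) - F x) = h * h * partial j (partial i F) y.
Proof.
move=> [F1 F2] h0; have [di _] := F1 i; have [dji _] := F2 i j.
pose phi s := F (x + h *: delta_mx j 0 + s *: delta_mx i 0) - F (x + s *: delta_mx i 0).
have [s /andP[s0 sh]] := der_mvt phi _ 0 h h0 (fun s _ => derB _ _ _ _ _
  (der_line F (x + h *: delta_mx j 0) i s di) (der_line F x i s di)).
rewrite subr0 /phi scale0r !addr0 [x + h *: delta_mx j 0 + _]addrAC => ->.
have [t /andP[t0 th]] := der_mvt _ _ 0 h h0 (fun t _ =>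
   der_line (partial i F) (x + s *: delta_mx i 0) j t dji).
rewrite subr0 scale0r addr0 addrAC => ->.
exists (x + s *: delta_mx i 0 + t *: delta_mx j 0); split; last by ring.
move=> k; rewrite !mxE -addrA addrAC subrr add0r.
have b (r : R) (q : bool) : 0 < r -> r < h -> `|r * q%:R| <= h.
  by move=> r0 rh; case: q; rewrite ?mulr1 ?mulr0 ?normr0 ?(ltW h0)// gtr0_norm// ltW.
apply: (le_trans (ler_normD _ _)).
by have := b s _ s0 sh; have := b t _ t0 th => B1 B2; rewrite mulr2n mulrDl mul1r lerD.
Qed.

(** The second difference of [F] is symmetric in the two directions, and two mean value steps in
    either order express it by one or the other mixed derivative at points within [2 h] of [x]. *)
Lemma partialC F (x : 'cV[R]_n) i j : classC2 F -> partial i (partial j F) x = partial j (partial i F) x.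
Proof.
move=> hF; have [_ F2] := hF.
apply/eqP; rewrite -subr_eq0 -normr_le0; apply/ler_addgt0Pr => e e0; rewrite add0r.
have e2 : 0 < e / 2 by rewrite divr_gt0.
have [_ /(_ x) c1] := F2 j i; have [_ /(_ x) c2] := F2 i j.
have [d1 d10 h1] := near_dist_cV _ _ _ c1 e2.
have [d2 d20 h2] := near_dist_cV _ _ _ c2 e2.
pose h := Num.min d1 d2 / 3.
have m0 : 0 < Num.min d1 d2 by rewrite lt_min d10.
have h0 : 0 < h by rewrite divr_gt0.
have hd1 : 2 * h < d1.
  have : Num.min d1 d2 <= d1 by rewrite ge_min lexx.
  by rewrite /h; lra.
have hd2 : 2 * h < d2.
  have : Num.min d1 d2 <= d2 by rewrite ge_min lexx orbT.
  by rewrite /h; lra.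
have [y [hy ey]] := second_difference F x i j h hF h0.
have [z [hz ez]] := second_difference F x j i h hF h0.
have : partial j (partial i F) y = partial i (partial j F) z.
  have hh : h * h != 0 by rewrite mulf_neq0// gt_eqF.
  apply: (mulfI hh); apply: (etrans (esym ey)); apply: etrans ez.
  by rewrite [x + h *: delta_mx j 0 + _]addrAC; ring.
move=> {ey ez}.
have := h2 y (fun k => le_lt_trans (hy k) hd2).
have := h1 z (fun k => le_lt_trans (hz k) hd1).
move: (partial j (partial i F) y) (partial i (partial j F) z)
  (partial j (partial i F) x) (partial i (partial j F) x) => A A' D D'.
by rewrite !ltr_norml ler_norml; lra.
Qed.

End SeveralVariables.

(** * Square integrable solutions *)

Section LineIntegrals.
Context {R : realType}.
Local Notation mu := (@lebesgue_measure R).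

Lemma der_LRcontinuous (F F' : R -> R) a b : (forall x, der F x (F' x)) ->
  derivable_oo_LRcontinuous F a b /\ {in `]a, b[, derive1 F =1 F'}.
Proof.
move=> dF; split; last first.
  by move=> x _; rewrite derive1E; case: (dF x).
split.
- by move=> x _; case: (dF x).
- by apply: cvg_at_right_filter; exact: (der_cont _ _ _ (dF a)).
- by apply: cvg_at_left_filter; exact: (der_cont _ _ _ (dF b)).
Qed.

(** Over each symmetric window the integral is at most the increment of [H], hence at most [2 M];
    monotone convergence concludes. *)
Lemma integral_line_lty (q H H' : R -> R) (M : R) : continuous q ->
  (forall x, 0 <= q x) -> (forall x, der H x (H' x)) -> (forall x, q x <= H' x) ->
  (forall x, `|H x| <= M) -> (\int[mu]_x (q x)%:E < +oo)%E.
Proof.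
move=> cq q0 dH qH HM.
have [P [P0 dP]] := antiderivative q 0 cq.
pose F (i : nat) : set R := [set` `[- i.+1%:R, i.+1%:R]].
have mq : measurable_fun [set: R] (EFin \o q).
  by apply/measurable_EFinP; exact: continuous_measurable_fun.
have cv : (\int[mu]_(x in F i) (q x)%:E @[i --> \oo] --> \int[mu]_(x in \bigcup_i F i) (q x)%:E)%E.
  apply: ge0_nondecreasing_set_cvg_integral.
  - move=> i j ij; rewrite subsetEset => x; rewrite /F /= !in_itv /= => /andP[h1 h2].
    have : (i.+1%:R : R) <= j.+1%:R by rewrite ler_nat.
    by move=> h3; apply/andP; split; lra.
  - by move=> i; exact: measurable_itv.
  - by move=> i; exact: measurable_funTS.
  - by move=> i x _; rewrite lee_fin.
have FT : \bigcup_i F i = [set: R].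
  rewrite -subTset => x _; have [k _ /(_ k (leqnn k)) /= hk] := nbhs_infty_gtr `|x|.
  exists k => //; rewrite /F /= in_itv /= -ler_norml ltW// (lt_le_trans hk)// ler_nat.
  exact: leqnSn.
rewrite -FT; apply: (@le_lt_trans _ _ (2 * M)%:E); last exact: ltry.
rewrite -(cvg_lim _ cv)//; apply: lime_le; first by apply/cvg_ex; eexists; exact: cv.
apply: nearW => i.
have i0 : - i.+1%:R < i.+1%:R :> R by rewrite gtrN// ltr0n.
have [d1 d2] := der_LRcontinuous P q (- i.+1%:R) i.+1%:R dP.
rewrite /F (continuous_FTC2 i0 _ d1 d2); last exact: continuous_subspaceT.
rewrite -EFinB lee_fin.
have := der_mono_le P q H H' _ _ (ltW i0) (fun x _ => dP x) (fun x _ => dH x) (fun x _ => qH x).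
by have := HM i.+1%:R; have := HM (- i.+1%:R); rewrite !ler_norml; lra.
Qed.

Lemma continuous_Lfun2 (h : R -> R) : continuous h ->
  (\int[mu]_x (h x ^+ 2)%:E < +oo)%E -> h \in Lfun mu 2%:E.
Proof.
move=> ch hlt; have mh := continuous_measurable_fun ch.
rewrite inE; apply/andP; split; rewrite inE //=.
rewrite /finite_norm unlock poweR_lty//.
apply: le_lt_trans hlt; rewrite le_eqVlt; apply/orP; left; apply/eqP.
apply: eq_integral => x _.
by rewrite /= powR_mulrn// real_normK ?num_real.
Qed.

Lemma test_function_support (phi : R -> R) : test_function phi ->
  exists2 N, 0 < N & forall x, N < `|x| -> phi x = 0.
Proof.
move=> [_ /compact_bounded[M [Mr hM]]].
exists (`|M| + 1); first by rewrite ltr_pwDr.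
move=> x hx; apply: contrapT => /eqP p0.
have M1 : M < `|M| + 1 by rewrite (le_lt_trans (ler_norm M))// ltrDl.
have : `|x| <= `|M| + 1 := hM _ M1 x (@subset_closure _ [set y | phi y != 0] x p0).
by rewrite leNgt hx.
Qed.

Lemma weak_derivative_classical (f g : R -> R) : continuous g ->
  (forall x, der f x (g x)) -> weak_derivative f g.
Proof.
move=> cg df phi hphi; have [N N0 hN] := test_function_support phi hphi.
have [hd _] := hphi.
have dphi x : der phi x (derive1 phi x).
  by apply: DeriveDef; [exact: (hd 0%N)|rewrite derive1E].
have cphi' : continuous (derive1 phi).
  move=> x; apply: differentiable_continuous; apply/derivable1_diffP.
  exact: (hd 1%N).
have hN' x : N < `|x| -> derive1 phi x = 0.
  move=> hx; apply: der_uniq (dphi x) _; apply: der_near (der_cst 0 x).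
  apply: (near_ball _ _ (`|x| - N)); first by rewrite subr_gt0.
  move=> y hy; rewrite hN//.
  by have := lerB_dist x y; rewrite distrC; move: hy; lra.
(* [phi] is known to vanish only for [|x| > N]; one unit more kills the boundary terms at both
   ends. *)
pose b := N + 1.
have sup (h : R -> R) : (forall x, N < `|x| -> h x = 0) ->
    \int[mu]_x h x = \int[mu]_(x in `[- b, b]) h x.
  move=> hh; rewrite [RHS]Rintegral_mkcond; apply: eq_Rintegral => x _.
  rewrite patchE; case: ifPn => //; rewrite notin_setE /= in_itv /= -ler_norml => /negP.
  by rewrite -ltNge => hx; rewrite hh// (lt_trans _ hx)// /b ltrDl.
rewrite sup; last by move=> x /hN' ->; rewrite mulr0.
rewrite [in RHS]sup; last by move=> x /hN ->; rewrite mulr0.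
have bb : - b < b by rewrite /b; lra.
have [f1 f2] := der_LRcontinuous f g (- b) b df.
have [p1 p2] := der_LRcontinuous phi _ (- b) b dphi.
rewrite (Rintegration_by_parts bb _ f1 f2 _ p1 p2); try exact: continuous_subspaceT.
rewrite (hN b) ?(hN (- b)) ?mulr0 ?subrr ?sub0r// ?normrN ger0_norm /b; lra.
Qed.

Lemma ae_eq0_continuous (g : R -> R) : continuous g ->
  {ae mu, forall x, g x = 0} -> forall x, g x = 0.
Proof.
move=> cg [A [mA A0 hA]] x; apply: contrapT => gx.
have g0 : 0 < `|g x| by rewrite normr_gt0; apply/eqP.
have [d d0 hd] := near_dist g x _ (cg x) g0.
have sub : [set` `]x - d, x + d[] `<=` A.
  move=> y /=; rewrite in_itv /= => /andP[y1 y2]; apply: hA => /= gy.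
  have : `|y - x| < d by rewrite ltr_norml; lra.
  by move=> /hd; rewrite gy sub0r normrN ltxx.
have : (mu [set` `](x - d)%R, (x + d)%R[%R] <= mu A)%E by apply: le_measure; rewrite ?inE.
rewrite A0 lebesgue_measure_itv /= lte_fin.
have -> : x - d < x + d by lra.
rewrite -EFinB lee_fin; lra.
Qed.

End LineIntegrals.

(** * From bounded solutions to eigenfunctions *)

Section Eigenfunction.
Context {R : realType} {n : nat}.
Variables (c : R) (B : R -> 'M[R]_n) (K M0 del : R).
Hypotheses (K0 : 0 < K)
  (B_form : forall x u v, `|dot u (B x *m v)| <= K * (dot u u + dot v v))
  (B_cont : forall i j, continuous (fun x => B x i j))
  (del0 : 0 < del)
  (B_neg : forall x u, M0 <= `|x| -> dot u (B x *m u) <= - (del * dot u u)).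

Lemma dot_delta (i : 'I_n) (u : 'cV[R]_n) : dot (delta_mx i 0) u = u i 0.
Proof.
rewrite /dot (bigD1 i)//= mxE !eqxx mul1r big1 ?addr0// => j ji.
by rewrite mxE (negPf ji) mul0r.
Qed.

Lemma bounded_solution_derivative lam f f1 M : solution c B lam f f1 ->
  (forall x, dot (f x) (f x) <= M) -> exists M1, forall x, dot (f1 x) (f1 x) <= M1.
Proof.
move=> hf hM.
have fi i x : `|f x i 0| <= M + 1.
  have := dot_coord (f x) i; have := hM x; have := sqr_ge0 (f x i 0 - 1).
  by have := sqr_ge0 (f x i 0 + 1); rewrite ler_norml; nra.
pose G := K * (1 + M) + `|lam| * (M + 1).
have gi i x : `|(- (B x *m f x) + lam *: f x) i 0| <= G.
  rewrite mxE [X in `|X + _|]mxE [X in `|_ + X|]mxE.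
  apply: (le_trans (ler_normD _ _)); rewrite normrN normrM lerD ?ler_wpM2l//.
  rewrite -dot_delta; apply: (le_trans (B_form _ _ _)).
  by rewrite ler_wpM2l ?(ltW K0)// lerD// dot_delta mxE !eqxx.
have e x i : (- (c *: f1 x) - B x *m f x + lam *: f x) i 0 =
    (- (B x *m f x) + lam *: f x) i 0 - c * f1 x i 0 by rewrite !mxE; ring.
have f1i i := bounded_derivative (fun x => f x i 0) (fun x => f1 x i 0)
  (fun x => (- (B x *m f x) + lam *: f x) i 0) c (M + 1) G
  (fun x => proj1 (hf x) i) (fun x => der_eq _ _ _ _ (proj2 (hf x) i) (e x i)) (fi i) (gi i).
set C := _ + G in f1i.
exists (\sum_(i < n) C ^+ 2) => x; apply: ler_sum => i _.
have hC : `|f1 x i 0| <= C by exact: f1i.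
have C0 : 0 <= C by exact: le_trans hC.
by rewrite -expr2 -real_normK ?num_real// lerXn2r ?nnegrE.
Qed.

(** The derivative of [2 f.f1 + c |f|^2] is [2 (|f1|^2 - f.Bf + lam |f|^2)], which dominates the
    energy where [B] is negative. On [[- M0, M0]] the deficit, at most [4 K M + 2 del M], is covered
    by the derivative of [A atan x], a bounded function. *)
Lemma energy_primitive lam f f1 M : 0 <= lam -> solution c B lam f f1 ->
  (forall x, dot (f x) (f x) <= M) ->
  exists G G' N, [/\ forall x, der G x (G' x), forall x, `|G x| <= N &
    forall x, energy f f1 x <= G' x].
Proof.
move=> lam0 hf hM; have [M1 hM1] := bounded_solution_derivative lam f f1 M hf hM.
have Mge : 0 <= M by apply: le_trans (hM 0); exact: dot_ge0.
pose A := (4 * K * M + 2 * del * M) * (1 + M0 ^+ 2).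
have A0 : 0 <= A.
  by rewrite /A mulr_ge0 ?addr_ge0 ?sqr_ge0// !mulr_ge0// ltW.
pose k := 2^-1 + (2 * del)^-1.
have i0 : 0 < (2 * del)^-1 by rewrite invr_gt0 mulr_gt0.
have k0 : 0 <= k by rewrite /k; lra.
exists (fun x => k * (2 * dot (f x) (f1 x) + c * dot (f x) (f x) + A * atan x)),
  (fun x => k * (2 * (dot (f1 x) (f1 x) - dot (f x) (B x *m f x) + lam * dot (f x) (f x))
     + A * (1 + x ^+ 2)^-1)), (k * (M + M1 + `|c| * M + A * pi)).
split=> x.
- have [h1 h2] := hf x; apply: derZ; apply: derD; last first.
    by apply: derZ; exact: is_derive1_atan.
  apply: der_eq (derD _ _ _ _ _ (derZ 2 _ _ _ (vder_dot _ _ _ _ _ h1 h2))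
    (derZ c _ _ _ (vder_dot _ _ _ _ _ h1 h1))) _.
  by rewrite !dotE (dotC (f1 x) (f x)); ring.
- rewrite normrM ger0_norm// ler_wpM2l//.
  have h1 : `|c * dot (f x) (f x)| <= `|c| * M.
    by rewrite normrM ler_wpM2l// ger0_norm ?dot_ge0.
  have h2 : `|A * atan x| <= A * pi.
    rewrite normrM ger0_norm// ler_wpM2l// ler_norml.
    by have := atan_gtNpi2 x; have := atan_ltpi2 x; have := pi_gt0 R; lra.
  have := dot_amgm (f x) (f1 x); have := hM x; have := hM1 x.
  by move: h1 h2; rewrite !ler_norml; lra.
- suff H : 2 * del * dot (f x) (f x) + 2 * dot (f1 x) (f1 x) <= 2 * (dot (f1 x) (f1 x) - dot (f x) (B x *m f x) + lam * dot (f x) (f x))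
     + A * (1 + x ^+ 2)^-1.
    apply: le_trans (ler_wpM2l k0 H).
    have -> : k * (2 * del * dot (f x) (f x) + 2 * dot (f1 x) (f1 x)) =
       energy f f1 x + (del * dot (f x) (f x) + (2 * del)^-1 * (2 * dot (f1 x) (f1 x))).
      by rewrite /k /energy; field; rewrite gt_eqF.
    rewrite lerDl addr_ge0// mulr_ge0 ?dot_ge0 ?(ltW del0) ?(ltW i0)//.
    by rewrite mulr_ge0 ?dot_ge0.
  have xp : 0 < 1 + x ^+ 2 by rewrite ltr_pwDl// sqr_ge0.
  have hl : 0 <= lam * dot (f x) (f x) by rewrite mulr_ge0// dot_ge0.
  have [xM|xM] := leP M0 `|x|.
    have := B_neg x (f x) xM.
    have : 0 <= A * (1 + x ^+ 2)^-1 by rewrite mulr_ge0// invr_ge0 ltW.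
    lra.
  have : 4 * K * M + 2 * del * M <= A * (1 + x ^+ 2)^-1.
    rewrite ler_pdivlMr// /A ler_wpM2l//.
      by rewrite addr_ge0// !mulr_ge0// ltW.
    rewrite lerD2l -real_normK ?num_real// lerXn2r ?nnegrE// ltW//.
    exact: le_lt_trans xM.
  have := B_form x (f x) (f x); have := hM x.
  have h3 : 2 * del * dot (f x) (f x) <= 2 * del * M.
    by rewrite ler_wpM2l ?mulr_ge0 ?(ltW del0).
  have h4 : K * dot (f x) (f x) <= K * M by rewrite ler_wpM2l ?(ltW K0).
  by rewrite ler_norml; lra.
Qed.

(** Evaluate the form bound at the pair [B u], [2 K u] and absorb half of the left-hand side. *)
Lemma form_operator_bound x u : dot (B x *m u) (B x *m u) <= 4 * K ^+ 2 * dot u u.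
Proof.
have := B_form x (B x *m u) (2 * K *: u).
rewrite -scalemxAr !dotE ler_norml => /andP[_ h].
have : K * dot (B x *m u) (B x *m u) <= K * (4 * K ^+ 2 * dot u u) by lra.
by rewrite ler_pM2l.
Qed.

Lemma eigenvalue_of_bounded_solution lam f f1 M : 0 < lam -> solution c B lam f f1 ->
  (forall x, dot (f x) (f x) <= M) -> (exists x, f x != 0) ->
  L_eigenvalue c B (real_complex R lam).
Proof.
move=> lam0 hf hM [x0 fx0].
have [G [G' [N [dG bG EG]]]] := energy_primitive lam f f1 M (ltW lam0) hf hM.
have L2E (h : R -> R) C : continuous h -> 0 <= C -> (forall x, h x ^+ 2 <= C * energy f f1 x) ->
    h \in Lfun (@lebesgue_measure R) 2%:E.
  move=> ch C0 hC; apply: continuous_Lfun2 => //.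
  apply: (integral_line_lty (fun x => h x ^+ 2) (fun x => C * G x) (fun x => C * G' x) (C * N)).
  - by move=> x; apply: cvgM; exact: ch.
  - by move=> x; rewrite sqr_ge0.
  - by move=> x; apply: derZ; exact: dG.
  - by move=> x; apply: (le_trans (hC x)); rewrite ler_wpM2l.
  - by move=> x; rewrite normrM ger0_norm// ler_wpM2l.
pose f2 x := - (c *: f1 x) - B x *m f x + lam *: f x.
have cf i : continuous (fun x => f x i 0).
  by move=> x; have [h _] := hf x; exact: der_cont (h i).
have cf1 i : continuous (fun x => f1 x i 0).
  by move=> x; have [_ h] := hf x; exact: der_cont (h i).
have cf2 i : continuous (fun x => f2 x i 0).
  rewrite (_ : (fun x => f2 x i 0) = fun x => - (c * f1 x i 0) - (\sum_j B x i j * f x j 0) + lam * f x i 0).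
    move=> x; apply: cvgD; first apply: cvgB.
    - by apply: cvgN; apply: cvgM; [exact: cvg_cst|exact: cf1].
    - by apply: cvg_sumr => j _; apply: cvgM; [exact: B_cont|exact: cf].
    - by apply: cvgM; [exact: cvg_cst|exact: cf].
  by apply/funext => x; rewrite /f2 !mxE.
have E0 x : 0 <= energy f f1 x by exact: energy_ge0.
have fL i : (fun x => f x i 0) \in Lfun (@lebesgue_measure R) 2%:E.
  apply: (L2E _ 1) => // x; rewrite mul1r; apply: (le_trans (dot_coord _ _)).
  by rewrite lerDl dot_ge0.
have f1L i : (fun x => f1 x i 0) \in Lfun (@lebesgue_measure R) 2%:E.
  apply: (L2E _ 1) => // x; rewrite mul1r; apply: (le_trans (dot_coord _ _)).
  by rewrite lerDr dot_ge0.
have f2L i : (fun x => f2 x i 0) \in Lfun (@lebesgue_measure R) 2%:E.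
  (* The factor 3 comes from the square of a sum of three terms, and [12 * K ^+ 2] is 3 times the
     constant of [form_operator_bound]. *)
  apply: (L2E _ (3 * c ^+ 2 + 12 * K ^+ 2 + 3 * lam ^+ 2)) => //.
    by rewrite !addr_ge0// mulr_ge0// sqr_ge0.
  move=> x; apply: (le_trans (dot_coord (f2 x) i)); rewrite /f2 /energy.
  have := dot_amgm (- (c *: f1 x)) (- (B x *m f x)); have := dot_amgm (- (c *: f1 x)) (lam *: f x).
  have := dot_amgm (- (B x *m f x)) (lam *: f x); have := form_operator_bound x (f x).
  rewrite !dotE (dotC (B x *m f x) (f1 x)) (dotC (f x) (f1 x)) (dotC (B x *m f x) (f x)).
  have h1 : 0 <= K ^+ 2 * dot (f1 x) (f1 x) by rewrite mulr_ge0 ?sqr_ge0 ?dot_ge0.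
  have h2 : 0 <= c ^+ 2 * dot (f x) (f x) by rewrite mulr_ge0 ?sqr_ge0 ?dot_ge0.
  have h3 : 0 <= lam ^+ 2 * dot (f1 x) (f1 x) by rewrite mulr_ge0 ?sqr_ge0 ?dot_ge0.
  by rewrite !ler_norml; lra.
pose C (g : R -> 'cV[R]_n) x : 'cV[R[i]]_n := map_mx (real_complex R) (g x).
have reC (g : R -> 'cV[R]_n) i : re_coord (C g) i = fun x => g x i 0 by apply/funext => x; rewrite /re_coord mxE.
have imC (g : R -> 'cV[R]_n) i : im_coord (C g) i = cst 0 by apply/funext => x; rewrite /im_coord mxE.
have L2C (g : R -> 'cV[R]_n) : (forall i, (fun x => g x i 0) \in Lfun (@lebesgue_measure R) 2%:E) -> L2 (C g).
  move=> hg i; rewrite reC imC; split; first exact: hg.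
  apply: (L2E _ 0) => //; first exact: cst_continuous.
  by move=> x; rewrite mul0r expr0n.
have wC (g g1 : R -> 'cV[R]_n) : (forall i, continuous (fun x => g1 x i 0)) -> (forall x, vder g x (g1 x)) ->
    weak_derivative_Cn (C g) (C g1).
  move=> cg dg i; rewrite !reC !imC; split.
    by apply: weak_derivative_classical; [exact: cg|move=> x; exact: dg].
  by apply: weak_derivative_classical; [exact: cst_continuous|move=> x; exact: der_cst].
exists (C f); split.
  move=> hae; move: fx0; apply/negP; rewrite negbK; apply/eqP/matrixP => i j; rewrite ord1 mxE.
  apply: (ae_eq0_continuous (fun x => f x i 0)); first exact: cf.
  apply: negligibleS hae => x /=; apply: contra_not => /matrixP/(_ i 0).
  by rewrite /C !mxE => /eqP; rewrite fmorph_eq0 => /eqP.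
exists (C f1), (C f2); split.
  split; [exact: L2C|exact: L2C|exact: L2C| |].
  - by apply: wC => // x; have [] := hf x.
  - by apply: wC => // x; have [] := hf x.
apply: aeW => x; rewrite /C -!map_mxZ -map_mxM -!map_mxD; congr map_mx.
by rewrite /f2; apply/matrixP => i j; rewrite !mxE; ring.
Qed.

End Eigenfunction.

(** * Translations *)

Section Translation.
Context {R : realType}.
Local Notation mu := (@lebesgue_measure R).
Variable h : R.

Local Definition translate (x : R) : measurableTypeR R := x + h.

Local Lemma measurable_shift : measurable_fun [set: measurableTypeR R] translate.
Proof. by apply: measurable_funD => //; exact: measurable_id. Qed.

(** The pushforward agrees with Lebesgue measure on half-open intervals, which determine it. *)
Lemma lebesgue_measure_shift (A : set R) : measurable A ->
  pushforward mu translate A = mu A.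
Proof.
move=> mA; apply/esym/lebesgue_measure_unique => //=; first exact: measurable_shift.
move=> _ X [[a b] _ <-].
rewrite /pushforward.
have -> : translate @^-1` `]a, b] = [set` `]a - h, b - h]].
  apply/seteqP; split => x /=; rewrite !in_itv /= /translate => /andP[h1 h2]; apply/andP; split; lra.
rewrite !lebesgue_measure_itv /= !lte_fin ltrD2r.
by case: ifP => // _; rewrite -!EFinB; congr EFin; ring.
Qed.

Lemma ge0_integral_shift (D : set R) (f : R -> \bar R) : measurable D ->
  measurable_fun D f -> (forall x, 0 <= f x)%E ->
  (\int[mu]_(x in translate @^-1` D) f (x + h)%R = \int[mu]_(x in D) f x)%E.
Proof.
move=> mD mf f0.
rewrite -(ge0_integral_pushforward measurable_shift mu mD mf); last by move=> x _; exact: f0.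
apply: eq_measure_integral => [|ms A mA _]; first exact: measurable_shift.
exact: lebesgue_measure_shift.
Qed.

Lemma integralT_shift (f : R -> \bar R) : measurable_fun [set: R] f ->
  (\int[mu]_x f (x + h)%R = \int[mu]_x f x)%E.
Proof.
move=> mf; rewrite integralE [RHS]integralE; congr (_ - _)%E.
  have mp : measurable_fun [set: R] f^\+%E by exact: measurable_funepos.
  rewrite -(ge0_integral_shift setT f^\+%E measurableT mp (funepos_ge0 f)) preimage_setT.
  by apply: eq_integral => x _; rewrite !funeposE.
have mn : measurable_fun [set: R] f^\-%E by exact: measurable_funeneg.
rewrite -(ge0_integral_shift setT f^\-%E measurableT mn (funeneg_ge0 f)) preimage_setT.
by apply: eq_integral => x _; rewrite !funenegE.
Qed.

Lemma measurable_fun_shift (f : R -> R) : measurable_fun [set: R] f ->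
  measurable_fun [set: R] (fun x => f (x + h)).
Proof. by move=> mf; apply: (measurableT_comp mf); exact: measurable_shift. Qed.

Lemma ae_shift (P : R -> Prop) : {ae mu, forall x, P x} -> {ae mu, forall x, P (x + h)}.
Proof.
move=> [A [mA A0 hA]]; exists (translate @^-1` A); split.
- by rewrite -[X in measurable X]setTI; apply: measurable_shift.
- by rewrite -A0; exact: lebesgue_measure_shift.
- by move=> x /= hx; apply: hA.
Qed.

Lemma Lfun2_shift (f : R -> R) : f \in Lfun mu 2%:E -> (fun x => f (x + h)) \in Lfun mu 2%:E.
Proof.
rewrite inE => /andP[]; rewrite inE /= => mf; rewrite inE /= /finite_norm unlock => fl.
rewrite inE; apply/andP; split; rewrite inE /=; first exact: measurable_fun_shift.
rewrite /finite_norm unlock.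
have mg : measurable_fun [set: R] (fun x => `|(f x)%:E| `^ 2)%E.
  apply: (@measurableT_comp _ _ _ _ _ _ (fun x : \bar R => (x `^ 2)%E)); first exact: measurable_poweR.
  by apply: measurableT_comp => //; exact/measurable_EFinP.
by have := integralT_shift _ mg => /= ->.
Qed.

End Translation.

Section TranslationWeak.
Context {R : realType}.
Local Notation mu := (@lebesgue_measure R).
Variable h : R.

Lemma test_function_shift (phi : R -> R) : test_function phi ->
  test_function (fun x => phi (x - h)) /\ (forall x, derive1 (fun x => phi (x - h)) x = derive1 phi (x - h)).
Proof.
move=> hphi; have [hd _] := hphi; have [N N0 hN] := test_function_support phi hphi.
have E k x : derive1n k (fun x => phi (x - h)) x = derive1n k phi (x - h).
  elim: k x => [//|k ih] x; rewrite !derive1nS.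
  have dk : der (derive1n k phi) (x - h) (derive1 (derive1n k phi) (x - h)).
    by apply: DeriveDef; [exact: hd|rewrite derive1E].
  have := der_comp _ (fun x => x - h) x _ _ dk (derB _ _ _ _ _ (der_id x) (der_cst h x)).
  rewrite subr0 mulr1 => d; rewrite derive1E.
  have /funext -> : forall y, derive1n k (fun x => phi (x - h)) y = derive1n k phi (y - h) by exact: ih.
  by case: d.
split; last by move=> x; exact: (E 1%N).
split.
  move=> k x.
  have /funext -> : forall y, derive1n k (fun x => phi (x - h)) y = derive1n k phi (y - h) by exact: E.
  have dk : der (derive1n k phi) (x - h) (derive1 (derive1n k phi) (x - h)).
    by apply: DeriveDef; [exact: hd|rewrite derive1E].
  by have [] := der_comp _ (fun x => x - h) x _ _ dk (derB _ _ _ _ _ (der_id x) (der_cst h x)).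
pose I : set R := [set` `[h - N, h + N]].
apply: (@subclosed_compact _ _ I); [exact: closed_closure|exact: segment_compact|].
rewrite closureE; apply: smallest_sub; first exact: itv_closed.
move=> x /=; rewrite /I /= in_itv /= => /eqP hx.
have : `|x - h| <= N by rewrite leNgt; apply/negP => /hN.
by rewrite ler_norml => /andP[h1 h2]; apply/andP; split; lra.
Qed.

(** A change of variables moves the translation onto the test function. *)
Lemma weak_derivative_shift (f g : R -> R) : measurable_fun [set: R] f ->
  measurable_fun [set: R] g -> weak_derivative f g ->
  weak_derivative (fun x => f (x + h)) (fun x => g (x + h)).
Proof.
move=> mf mg hfg phi hphi; have [hs ds] := test_function_shift phi hphi.
have [hd _] := hphi.
have cphi k : continuous (derive1n k phi).
  move=> x; apply: differentiable_continuous; apply/derivable1_diffP; exact: hd.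
have mphi k : measurable_fun [set: R] (fun x => derive1n k phi (x - h)).
  apply: (measurable_fun_shift (- h) (derive1n k phi)).
  exact: continuous_measurable_fun (cphi k).
have sh (u : R -> R) k : measurable_fun [set: R] u ->
    \int[mu]_x (u (x + h) * derive1n k phi x) = \int[mu]_x (u x * derive1n k phi (x - h)).
  move=> mu'; rewrite /Rintegral.
  have m1 : measurable_fun [set: R] (fun x => (u x * derive1n k phi (x - h))%:E).
    by apply/measurable_EFinP; apply: measurable_funM.
  rewrite -(integralT_shift h _ m1); congr fine; apply: eq_integral => x _.
  by rewrite addrK.
have := hfg _ hs.
rewrite (sh f 1%N mf) (sh g 0%N mg) => <-.
by apply: eq_Rintegral => x _; rewrite ds.
Qed.

End TranslationWeak.

(** * Operators commuting with the unit translation *)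

Section PeriodicOperator.
Context {R : realType} {n : nat}.
Local Notation mu := (@lebesgue_measure R).
Variables (c : R) (B : R -> 'M[R]_n).
Hypothesis B_periodic : forall x, B (x + 1) = B x.
Implicit Types f : R -> 'cV[R[i]]_n.

Lemma L2_measurable f i : L2 f ->
  measurable_fun [set: R] (re_coord f i) /\ measurable_fun [set: R] (im_coord f i).
Proof.
by move=> /(_ i)[]; rewrite !inE => /andP[+ _] /andP[+ _]; rewrite !inE.
Qed.

Lemma L_graph_shift f g : L_graph c B f g -> L_graph c B (fun x => f (x + 1)) (fun x => g (x + 1)).
Proof.
move=> [f1 [f2 [[lf lf1 lf2 w1 w2] hae]]].
have sL (u : R -> 'cV[R[i]]_n) : L2 u -> L2 (fun x => u (x + 1)).
  move=> hu i; have [a1 a2] := hu i.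
  split; first exact: (Lfun2_shift 1 (re_coord u i)).
  exact: (Lfun2_shift 1 (im_coord u i)).
have sW (u v : R -> 'cV[R[i]]_n) : L2 u -> L2 v -> weak_derivative_Cn u v ->
    weak_derivative_Cn (fun x => u (x + 1)) (fun x => v (x + 1)).
  move=> lu lv huv i; have [a1 a2] := huv i.
  have [m1 m2] := L2_measurable u i lu; have [m3 m4] := L2_measurable v i lv.
  split; first exact: (weak_derivative_shift 1 (re_coord u i) (re_coord v i)).
  exact: (weak_derivative_shift 1 (im_coord u i) (im_coord v i)).
exists (fun x => f1 (x + 1)), (fun x => f2 (x + 1)); split.
  by split; [exact: sL|exact: sL|exact: sL|exact: sW|exact: sW].
have := ae_shift 1 _ hae; apply: negligibleS => x /=.
by rewrite B_periodic.
Qed.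

(** Real-valued, whereas the norm of [R[i]] takes its values in [R[i]]. *)
Definition sqr_modulus (z : R[i]) : R := complex.Re z ^+ 2 + complex.Im z ^+ 2.

Lemma sqr_modulus_ge0 z : 0 <= sqr_modulus z.
Proof. by rewrite addr_ge0// sqr_ge0. Qed.

Lemma sqr_modulusM z w : sqr_modulus (z * w) = sqr_modulus z * sqr_modulus w.
Proof. by case: z => a b; case: w => a' b'; rewrite /sqr_modulus /=; ring. Qed.

Lemma sqr_modulus_eq0 z : sqr_modulus z = 0 -> z = 0.
Proof.
case: z => a b /eqP; rewrite /sqr_modulus /= paddr_eq0 ?sqr_ge0// !sqrf_eq0.
by move=> /andP[/eqP -> /eqP ->].
Qed.

Definition sqr_norm f (x : R) : R := \sum_i sqr_modulus (f x i 0).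

Lemma sqr_norm_ge0 f x : 0 <= sqr_norm f x.
Proof. by apply: sumr_ge0 => i _; exact: sqr_modulus_ge0. Qed.

Lemma sqr_norm_integrable f : L2 f -> mu.-integrable [set: R] (EFin \o sqr_norm f).
Proof.
move=> lf.
rewrite (_ : EFin \o sqr_norm f = fun x => (\sum_(i < n) ((re_coord f i x ^+ 2)%:E + (im_coord f i x ^+ 2)%:E))%E).
  apply: integrable_sum => // i _; have [a1 a2] := lf i.
  by apply: integrableD => //; exact: Lfun2_integrable_sqr.
by apply/funext => x; rewrite /= /sqr_norm -sumEFin.
Qed.

Lemma periodic_not_simple : ~ simple_eigenvalue c B 0.
Proof.
move=> [f [f0 Lf] hsimple].
have lf : L2 f by have [f1 [f2 [[h _ _ _ _] _]]] := Lf.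
have [a ha] : exists a : R[i], ae_equal (fun x => f (x + 1)) (fun x => a *: f x).
  (* The translate of [f] lies in the kernel of [L], so the first power suffices. *)
  apply: (hsimple 1%N); exists (fun x => 0 *: f (x + 1)); first exact: (L_graph_shift _ _ Lf).
  by apply: aeW => x; rewrite subrr.
pose q := sqr_norm f; pose s := sqr_modulus a.
have qi := sqr_norm_integrable f lf.
have mq : measurable_fun [set: R] (EFin \o q) by have /integrableP[] := qi.
have mq1 : measurable_fun [set: R] (fun x => (q (x + 1)%R)%:E).
  apply/measurable_EFinP; apply: (measurable_fun_shift 1 q); exact/measurable_EFinP.
have q0 x : (0 <= (q x)%:E)%E by rewrite lee_fin sqr_norm_ge0.
have qs : {ae mu, forall x, (q (x + 1))%:E = (s * q x)%:E}.
  apply: negligibleS ha => x /=; apply: contra_not => e.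
  rewrite /q /sqr_norm e mulr_sumr; congr EFin; apply: eq_bigr => i _.
  by rewrite mxE sqr_modulusM.
pose J D := (\int[mu]_(x in D) (q x)%:E)%E.
have step (D : set R) : measurable D -> measurable (translate 1 @^-1` D) ->
    (J D = s%:E * J (translate 1 @^-1` D))%E.
  move=> mD mD'; rewrite /J -(ge0_integral_shift 1 D (fun x => (q x)%:E)) //; last exact: measurable_funTS.
  rewrite -ge0_integralZl_EFin//; last 2 first.
  - exact: measurable_funTS.
  - exact: sqr_modulus_ge0.
  apply: ge0_ae_eq_integral => //.
  - exact: measurable_funTS.
  - under eq_fun do rewrite -EFinM.
    apply: measurable_funTS; apply/measurable_EFinP; apply: measurable_funM => //.
    exact/measurable_EFinP.
  - by move=> x _; rewrite mule_ge0// lee_fin sqr_modulus_ge0.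
  - apply: negligibleS qs => x /=; apply: contra_not => e _; exact: e.
have Jfin D : measurable D -> J D \is a fin_num.
  move=> mD; apply: integrable_fin_num => //; exact: integrableS qi.
have JT0 : J setT != 0%E.
  apply/negP => /eqP JT; apply: f0.
  have /(ae_eq_integral_abs mu measurableT mq) : (\int[mu]_x `|(EFin \o q) x| = 0)%E.
    by rewrite -[RHS]JT; apply: eq_integral => x _; rewrite gee0_abs//; exact: q0.
  apply: negligibleS => x /=; apply: contra_not => /(_ I) /= [qx].
  apply/matrixP => i j; rewrite ord1 mxE; apply: sqr_modulus_eq0; apply/eqP.
  rewrite eq_le sqr_modulus_ge0 andbT -qx /q /sqr_norm (bigD1 i)//= lerDl.
  by apply: sumr_ge0 => k _; exact: sqr_modulus_ge0.
(* The total mass is finite, nonzero, and equal to [s] times itself. *)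
have s1 : s = 1.
  have := step setT measurableT; rewrite preimage_setT => /(_ measurableT).
  move: JT0 (Jfin setT measurableT); case: (J setT) => [r| |]//.
  rewrite eqe => r0 _ []; rewrite -[LHS]mul1r => /(mulIf r0) <- //.
pose half (r : R) : set R := [set` `[r, +oo[].
have Jhalf r (k : nat) : J (half (r + k%:R)) = J (half r).
  elim: k r => [|k ih] r; first by rewrite addr0.
  have -> : r + k.+1%:R = (r + k%:R) + 1 by rewrite -addn1 natrD addrA.
  rewrite step ?s1; [|exact: measurable_itv|]; rewrite (_ : translate 1 @^-1` half (r + k%:R + 1) = half (r + k%:R)).
  - by rewrite mul1e ih.
  - by apply/seteqP; split => x; rewrite /half /translate /= !in_itv /= !andbT lerD2r.
  - exact: measurable_itv.
  - by apply/seteqP; split => x; rewrite /half /translate /= !in_itv /= !andbT lerD2r.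
pose F (k : nat) : set R := [set` `[- k%:R, k%:R[].
(* The half-lines from [- k] and from [k] differ by a translation of [2 k] units, so they have equal
   finite mass and [F k] between them has none. *)
have JF k : J (F k) = 0%E.
  have kk : - k%:R <= k%:R :> R by have := ler0n R k; lra.
  have e : half (- k%:R) = F k `|` half k%:R.
    apply/seteqP; split => x; rewrite /half /F /= !in_itv /= !andbT.
      by move=> h1; rewrite h1 /=; have [h2|h2] := ltP x k%:R; [left|right].
    by move=> [/andP[]//|]; exact: le_trans.
  have dis : [disjoint F k & half k%:R].
    rewrite disj_set2E; apply/eqP/seteqP; split => x //=.
    by rewrite /half /F /= !in_itv /= andbT => -[/andP[_ h1]]; rewrite leNgt h1.
  have := Jhalf (- k%:R) (2 * k)%N.
  have -> : - k%:R + (2 * k)%:R = k%:R :> R by rewrite natrM; ring.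
  rewrite e {2}/J ge0_integral_setU//; [|exact: measurable_itv|exact: measurable_itv|exact: measurable_funTS].
  rewrite -/(J (F k)) -/(J (half k%:R)).
  have := Jfin (half k%:R) (measurable_itv _); have := Jfin (F k) (measurable_itv _).
  case: (J (half k%:R)) => [u| |]//; case: (J (F k)) => [v| |]// _ _ [].
  by move=> h1; congr EFin; lra.
have cv : (J (F k) @[k --> \oo] --> J (\bigcup_k F k)).
  apply: ge0_nondecreasing_set_cvg_integral.
  - move=> i j ij; rewrite subsetEset => x; rewrite /F /= !in_itv /= => /andP[h1 h2].
    have : (i%:R : R) <= j%:R by rewrite ler_nat.
    by move=> h3; apply/andP; split; lra.
  - by move=> i; exact: measurable_itv.
  - by move=> i; exact: measurable_funTS.
  - by move=> i x _.
have FT : \bigcup_k F k = [set: R].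
  rewrite -subTset => x _; have [k _ /(_ k (leqnn k)) /= hk] := nbhs_infty_gtr `|x|.
  exists k => //; rewrite /F /= in_itv /=.
  by move: hk; rewrite ltr_norml => /andP[/ltW -> ->].
move/negP: JT0; apply; apply/eqP; rewrite -FT -(cvg_lim _ cv)//.
by rewrite (_ : (fun k => J (F k)) = cst 0%E) ?lim_cst//; apply/funext.
Qed.

End PeriodicOperator.

(** * The linearization at the wave *)

Section LimitsAtInfinity.
Context {R : realType}.

Lemma bounded_of_limits (h : R -> R) (l l' : R) : continuous h ->
  h x @[x --> +oo] --> l -> h x @[x --> -oo] --> l' -> exists M, forall x, `|h x| <= M.
Proof.
move=> ch hl hl'.
have [X [_ hX]] : \forall x \near +oo, `|h x - l| < 1.
  by move/cvgrPdist_lt: hl => /(_ 1 ltr01); apply: filterS => x; rewrite distrC.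
have [Y [_ hY]] : \forall x \near -oo, `|h x - l'| < 1.
  by move/cvgrPdist_lt: hl' => /(_ 1 ltr01); apply: filterS => x; rewrite distrC.
pose a := Num.min X Y; pose b := Num.max X Y.
have ab : a <= b by rewrite le_max ge_min lexx.
have [|z _ hz] := @EVT_max R (fun x => `|h x|) a b ab.
  by apply: continuous_subspaceT => x; apply: continuous_comp; [exact: ch|exact: norm_continuous].
exists (`|h z| + `|l| + `|l'| + 1) => x.
have n1 := normr_ge0 (h z); have n2 := normr_ge0 l; have n3 := normr_ge0 l'.
have [Xx|xX] := ltP X x.
  by have := hX x Xx; have := lerB_dist (h x) l; lra.
have [xY|Yx] := ltP x Y.
  by have := hY x xY; have := lerB_dist (h x) l'; lra.
have : `|h x| <= `|h z|.
  by apply: hz; rewrite in_itv /= ge_min Yx orbT /= le_max xX.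
lra.
Qed.

Lemma cvg_coord {m p : nat} (U : set_system R) {FU : Filter U} (A : R -> 'M[R]_(m, p)) (L : 'M[R]_(m, p)) i j :
  A x @[x --> U] --> L -> A x i j @[x --> U] --> L i j.
Proof.
move=> hA; apply: (cvg_comp A (fun M : 'M[R]_(m, p) => M i j)); first exact: hA.
exact: coord_continuous.
Qed.

Lemma vder_of_derivable {n} (w : R -> 'cV[R]_n) x : derivable w x 1 -> vder w x (derive1 w x).
Proof.
move=> hw i; have /derivable_mxP/(_ i 0) hi := hw.
by apply: DeriveDef => //; rewrite derive1E (derive_mx hw) mxE.
Qed.

(** Compactness of the unit sphere: if no constant worked, unit vectors with [u.Au > - 1 / (k + 1)]
    would have a unit limit at which the form is not negative. *)
Lemma negative_definite_coercive {n} (A : 'M[R]_n) : negative_definite A ->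
  exists2 d, 0 < d & forall u, dot u (A *m u) <= - (d * dot u u).
Proof.
move=> hA; apply: contrapT => hn.
have dotA (u : 'cV[R]_n) : (u^T *m A *m u) 0 0 = dot u (A *m u).
  by rewrite -mulmxA mxE; apply: eq_bigr => i _; rewrite mxE.
have /choice[v hv] (k : nat) : exists u : 'cV[R]_n, dot u u = 1 /\ - k.+1%:R^-1 < dot u (A *m u).
  have k0 : (0 : R) < k.+1%:R^-1 by rewrite invr_gt0 ltr0n.
  have [u hu] : exists u : 'cV[R]_n, - (k.+1%:R^-1 * dot u u) < dot u (A *m u).
    apply: contrapT => hk; apply: hn; exists k.+1%:R^-1 => // u.
    by rewrite leNgt; apply/negP => h; apply: hk; exists u.
  have u0 : 0 < dot u u.
    rewrite lt_def dot_ge0 andbT; apply/eqP => /dot_eq0 e; move: hu.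
    by rewrite e !dot0l mulr0 oppr0 ltxx.
  pose r := (Num.sqrt (dot u u))^-1.
  have r2 : r * r = (dot u u)^-1.
    by rewrite /r -expr2 exprVn sqr_sqrtr// ltW.
  exists (r *: u); rewrite -scalemxAr !dotE !mulrA r2; split; first by rewrite mulVf// gt_eqF.
  by rewrite mulrC ltr_pdivlMr// mulNr.
have [U [UU hU]] := ultraFilterLemma (@eventually_filter).
have /choice[u hu] i : exists l : R, v k i 0 @[k --> U] --> l.
  apply: (ultra_bounded_cvg _ _ _ 1); apply: nearW => k.
  rewrite -(@expr_le1 _ 2)// real_normK ?num_real//.
  by have [<- _] := hv k; exact: dot_coord.
pose z : 'cV[R]_n := \col_i u i.
have vz i : v k i 0 @[k --> U] --> z i 0 by rewrite mxE.
have zz : dot z z = 1.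
  have h1 : dot (v k) (v k) @[k --> U] --> dot z z by exact: cvg_dot.
  have h2 : dot (v k) (v k) @[k --> U] --> (1 : R).
    rewrite (_ : (fun k => _) = cst 1); first exact: cvg_cst.
    by apply/funext => k; have [->] := hv k.
  exact: (cvg_unique _ h1 h2).
have zA : dot (v k) (A *m v k) @[k --> U] --> dot z (A *m z).
  apply: cvg_dot => // i; rewrite mxE; under eq_fun do rewrite mxE.
  by apply: cvg_sumr => j _; apply: cvgM; [exact: cvg_cst|exact: vz].
have z0 : z != 0 by apply/eqP => e; move: zz; rewrite e dot0l => /eqP; rewrite eq_sym oner_eq0.
have := hA z z0; rewrite dotA => L0.
pose L := dot z (A *m z).
have L2 : dot z (A *m z) < L / 2 by rewrite /L; move: L0; lra.
have n1 := cvgr_lt _ zA _ L2.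
have e0 : 0 < - L / 2 by rewrite /L; move: L0; lra.
have n2 := hU _ (near_infty_natSinv_lt (PosNum e0)).
have [k [/= h1 h2]] := filter_ex (filterI (n1 _) n2).
have [_ h3] := hv k; have {}h2 : k.+1%:R^-1 < - L / 2 := h2.
have : - k.+1%:R^-1 < L / 2 by exact: lt_trans h3 h1.
move: h2; move: (k.+1%:R^-1) => y; lra.
Qed.

Lemma negative_near {n} (U : set_system R) {FU : Filter U} (B : R -> 'M[R]_n) (A : 'M[R]_n) :
  B x @[x --> U] --> A -> negative_definite A ->
  exists2 d, 0 < d & \forall x \near U, forall u, dot u (B x *m u) <= - (d * dot u u).
Proof.
move=> hB /negative_definite_coercive[d d0 hd].
(* Entries within [eta] of [A] change the form by at most [2 n eta |u|^2], which is at most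
   [d / 2 |u|^2]; [n.+1] keeps the denominator nonzero when [n = 0]. *)
pose eta := d / (4 * n.+1%:R).
have n0 : (0 : R) < n.+1%:R by rewrite ltr0n.
have eta0 : 0 < eta by rewrite divr_gt0// mulr_gt0.
exists (d / 2); first by rewrite divr_gt0.
have /cvg_ballP/(_ eta eta0) := hB; apply: filterS => x [_ hx] u.
have bx i j : `|(B x - A) i j| <= eta.
  by have := hx i j; rewrite /ball /= distrC !mxE => /ltW.
have := dot_bilinear_bound (B x - A) eta u u bx (ltW eta0).
rewrite mulmxBl dotDr dotNr.
have : n%:R * eta * (dot u u + dot u u) <= d / 2 * dot u u.
  have -> : d / 2 * dot u u = n.+1%:R * eta * (dot u u + dot u u).
    by rewrite /eta; field; rewrite -natr1 in n0 *; rewrite gt_eqF.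
  rewrite ler_wpM2r ?addr_ge0 ?dot_ge0// ler_wpM2r ?(ltW eta0)//.
  by rewrite ler_nat leqnSn.
have := hd u; rewrite ler_norml.
have -> : - (d / 2 * dot u u) = - (d * dot u u) + d / 2 * dot u u by field.
lra.
Qed.

End LimitsAtInfinity.

(** * The derivative of the wave *)

Section Wave.
Context {R : realType} {n : nat}.
Variables (F : 'cV[R]_n -> R) (c : R) (um up : 'cV[R]_n) (w : R -> 'cV[R]_n).
Hypotheses (F_C2 : classC2 F) (w_wave : traveling_wave F c um up w).

Local Notation w1 := (derive1 w).
Local Notation w2 := (derive1 (derive1 w)).

Lemma wave_vder x : vder w x (w1 x) /\ vder w1 x (w2 x).
Proof.
by have [h _ _ _] := w_wave; have [h1 h2] := h x; split; exact: vder_of_derivable.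
Qed.

Lemma wave_second_derivative x i :
  w2 x i 0 = - partial i F (w x) - c * w1 x i 0.
Proof.
have [_ /(_ x) h _ _] := w_wave; move/matrixP: h => /(_ i 0).
rewrite /derive1n /= !mxE => /eqP; rewrite -addrA addr_eq0 => /eqP ->.
by ring.
Qed.

Lemma wave_continuous : continuous w.
Proof.
move=> x; have [h _ _ _] := w_wave; have [h1 _] := h x.
by apply: differentiable_continuous; apply/derivable1_diffP.
Qed.

Lemma linearization_sym x u v :
  dot u (linearization F w x *m v) = dot (linearization F w x *m u) v.
Proof.
rewrite dot_mx; congr (dot (_ *m _) _); apply/matrixP => i j; rewrite !mxE.
exact: partialC.
Qed.

Lemma linearization_continuous i j : continuous (fun x => linearization F w x i j).
Proof.
have [_ F2] := F_C2; have [_ cF] := F2 j i.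
under eq_fun do rewrite mxE.
move=> x; apply: (continuous_comp (f := w)); [exact: wave_continuous|exact: cF].
Qed.

(** The wave is given as twice differentiable; the equation writes [w''] as a differentiable
    function of [x], and differentiating it gives [L w' = 0]. *)
Lemma wave_derivative_solution : solution c (linearization F w) 0 w1 w2.
Proof.
move=> x; have [h1 h2] := wave_vder x; split => // i.
have [_ F2] := F_C2; have hc : classC1 (partial i F) by exact: F2.
have d := derB _ _ _ _ _ (derN _ _ _ (chain_rule _ _ _ _ hc h1)) (derZ c _ _ _ (h2 i)).
apply: (der_ext (fun y => - partial i F (w y) - c * w1 y i 0)).
  by move=> y; apply/esym; exact: wave_second_derivative.
apply: der_eq d _; rewrite scale0r addr0 !mxE.
rewrite (eq_bigr (fun k => linearization F w x i k * w1 x k 0)); first by ring.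
by move=> k _; rewrite mxE partialC.
Qed.

(** The limits at infinity bound [w] and the gradient along it; [bounded_derivative] then bounds
    [w']. *)
Lemma wave_derivative_bounded : exists M, forall x, dot (w1 x) (w1 x) <= M.
Proof.
have [_ _ wm wp] := w_wave.
have cw i : continuous (fun x => w x i 0).
  by move=> x; have [h _] := wave_vder x; exact: der_cont (h i).
have /choice[M hM] i : exists M, forall x, `|w x i 0| <= M.
  by apply: bounded_of_limits; [exact: cw|exact: cvg_coord wp|exact: cvg_coord wm].
have cg i : continuous (partial i F) by have [F1 _] := F_C2; have [] := F1 i.
have /choice[G hG] i : exists M, forall x, `|- partial i F (w x)| <= M.
  apply: (bounded_of_limits _ (- partial i F up) (- partial i F um)).
  - move=> x; apply: cvgN; apply: (continuous_comp (f := w)); [exact: wave_continuous|exact: cg].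
  - by apply: cvgN; apply: cvg_comp wp _; exact: cg.
  - by apply: cvgN; apply: cvg_comp wm _; exact: cg.
have b i x := bounded_derivative (fun x => w x i 0) (fun x => w1 x i 0)
  (fun x => - partial i F (w x)) c (M i) (G i) (fun x => (wave_vder x).1 i)
  (fun x => der_eq _ _ _ _ ((wave_vder x).2 i) (wave_second_derivative x i)) (hM i) (hG i) x.
exists (\sum_i (2 * M i + 2 * `|c| * M i + G i) ^+ 2) => x; apply: ler_sum => i _.
have b0 := le_trans (normr_ge0 _) (b i x).
by rewrite -expr2 -real_normK ?num_real// lerXn2r ?nnegrE.
Qed.

End Wave.

Theorem theorem3p4 (R : realType) (n : nat) (F : 'cV[R]_n -> R) (c : R)
    (um up : 'cV[R]_n) (w : R -> 'cV[R]_n) (Bm Bp : 'M[R]_n)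
    (F_C2 : classC2 F)
    (um_crit : gradient F um = 0) (up_crit : gradient F up = 0)
    (w_wave : traveling_wave F c um up w)
    (B_limm : linearization F w x @[x --> -oo] --> Bm)
    (B_limp : linearization F w x @[x --> +oo] --> Bp)
    (Bm_neg : negative_definite Bm) (Bp_neg : negative_definite Bp)
    (w_nondeg : nondegenerate_wave F c w)
    (w_crit : exists xi0 : R, derive1 w xi0 = 0) :
  spectrally_unstable F c w.
Proof.
move=> stable.
pose B := linearization F w.
have Bsym : forall x u v, dot u (B x *m v) = dot (B x *m u) v by exact: linearization_sym.
have Bcont : forall i j, continuous (fun x => B x i j).
  exact: linearization_continuous w_wave.
have /choice[bb hbb] (p : 'I_n * 'I_n) : exists M, forall x, `|B x p.1 p.2| <= M.
  by apply: bounded_of_limits; [exact: Bcont|exact: cvg_coord B_limp|exact: cvg_coord B_limm].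
pose b := \sum_p `|bb p|.
have b0 : 0 <= b by exact: sumr_ge0.
have Bb x i j : `|B x i j| <= b.
  apply: (le_trans (hbb (i, j) x)); apply: (le_trans (ler_norm _)).
  by rewrite /b (bigD1 (i, j))//= lerDl sumr_ge0.
pose K := n%:R * b + 1.
have K0 : 0 < K by rewrite /K ltr_wpDl// mulr_ge0.
have Bform x u v : `|dot u (B x *m v)| <= K * (dot u u + dot v v).
  apply: (le_trans (dot_bilinear_bound (B x) b u v (Bb x) b0)).
  by rewrite ler_wpM2r ?addr_ge0 ?dot_ge0// /K lerDl.
have [dp dp0 [X [_ hX]]] := negative_near _ _ _ B_limp Bp_neg.
have [dm dm0 [Y [_ hY]]] := negative_near _ _ _ B_limm Bm_neg.
pose M0 := `|X| + `|Y| + 1; pose d := Num.min dp dm.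
have M00 : 0 < M0 by rewrite /M0 ltr_wpDl// addr_ge0.
have d0 : 0 < d by rewrite lt_min dp0.
have Bneg x u : M0 <= `|x| -> dot u (B x *m u) <= - (d * dot u u).
  have n1 := normr_ge0 X; have n2 := normr_ge0 Y.
  have n3 := ler_norm X; have n4 : - `|Y| <= Y by rewrite lerNl -normrN ler_norm.
  have dd e : d <= e -> - (e * dot u u) <= - (d * dot u u).
    by move=> de; rewrite lerN2 ler_wpM2r ?dot_ge0.
  have [x0|x0] := leP 0 x.
    rewrite ger0_norm// /M0 => hx; have Xx : X < x by lra.
    by apply: (le_trans (hX x Xx u)); apply: dd; rewrite ge_min lexx.
  rewrite ltr0_norm// /M0 => hx; have xY : x < Y by lra.
  by apply: (le_trans (hY x xY u)); apply: dd; rewrite ge_min lexx orbT.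
have Bneg0 x u : M0 <= `|x| -> dot u (B x *m u) <= 0.
  by move=> /(Bneg x u)/le_trans; apply; rewrite oppr_le0 mulr_ge0 ?dot_ge0// ltW.
have hsol := wave_derivative_solution _ _ _ _ _ F_C2 w_wave.
have [M hM] := wave_derivative_bounded _ _ _ _ _ F_C2 w_wave.
have [x0 wx0] := w_crit.
(* If [w''] also vanishes at [x0], uniqueness forces [w' = 0] everywhere and [B] is invariant under
   translation; otherwise [w'] has at [x0] the corner needed for the trial function. *)
have [w20|w20] := eqVneq (derive1 (derive1 w) x0) 0.
  have w10 := solution_eq0 c B K K0 Bform 0 _ _ x0 hsol wx0 w20.
  have wE x : w (x + 1) = w x.
    apply/matrixP => i j; rewrite ord1.
    apply: (der0_cst (fun t => w t i 0)); first by rewrite lerDl.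
    move=> y _; have [h _] := wave_vder _ _ _ _ _ w_wave y.
    by apply: der_eq (h i) _; have [-> _] := w10 y; rewrite mxE.
  by apply: (periodic_not_simple c B) w_nondeg => x; rewrite /B /linearization wE.
have [lam [f [f1 [M' [lam0 hf fM e1]]]]] := bounded_eigensolution R n c B K b M0 _ _ x0 M
  K0 Bform Bsym Bcont Bb M00 Bneg0 hsol hM wx0 w20.
have fx : exists x, f x != 0.
  apply: contrapT => hn.
  have [] := solution_eq0_itv c B K K0 Bform lam f f1 0 1 hf ltr01 _ 0.
    by move=> x _; apply/eqP/negPn/negP => h; apply: hn; exists x.
  by move: e1; rewrite /energy => /[swap] -> /[swap] ->; rewrite dot0l addr0 => /eqP; rewrite eq_sym oner_eq0.
have ev := eigenvalue_of_bounded_solution c B K M0 d K0 Bform Bcont d0 Bneg lam f f1 M' lam0 hf fM fx.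
have := stable _ ev; rewrite fmorph_eq0 gt_eqF// => /(_ isT).
by rewrite -(rmorph0 (real_complex R)) ltcR ltNge ltW.
Qed.
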